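(* Let $p\in\mathbb{C}\setminus\mathbb{Z}_{\leqslant 0}$ and $m,n\in\mathbb{Z}_{\geqslant 0}$. Then \[ \begin{aligned} \sum_{k=1}^{\infty}\frac{(-1)^nH_{k-1}}{k\,(p+n+k)^{m+1}\binom{n+k}{k}} &=\frac12\sum_{k=0}^{n}\frac{(-1)^k}{(p+k)^{m+1}}\binom{n}{k}\left\{H_n^2+H_n^{(2)}-H_{n-k}^2-H_{n-k}^{(2)}\right\}\\ &\quad+\frac{(-1)^m}{2\,m!}\,\frac{\partial^m}{\partial s^m}\left[\left(\frac{\partial^2}{\partial x^2}-2H_n\frac{\partial}{\partial x}\right)\frac{\Gamma(x+1)\Gamma(s)}{\Gamma(x+s+1)}\right]_{x=n,\,s=p}. \end{aligned} \]
   Context: $\Gamma$ is Euler's gamma function. $H_n^{(s)}=\sum_{j=1}^{n}j^{-s}$ are the generalized harmonic numbers, $H_n=H_n^{(1)}$, $H_0=H_0^{(2)}=0$. $\binom{a}{b}$ is the usual binomial coefficient. *)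

(* Defs.v *)
From HB Require Import structures.
From mathcomp Require Import all_boot all_order all_algebra complex.
From mathcomp Require Import all_classical all_reals all_analysis.
Set Implicit Arguments. Unset Strict Implicit. Unset Printing Implicit Defensive.
Import Order.TTheory GRing.Theory Num.Theory.
Export numFieldNormedType.Exports.
Local Open Scope ring_scope.
Local Open Scope complex_scope.
Local Open Scope classical_set_scope.

(* Limits and derivatives of complex-valued maps are taken in R[i]^o, i.e. R[i]
   as a normed space over itself: R[i] alone carries no topology, and derive1n
   over R[i] is the iterated complex derivative. *)

Definition cexp (R : realType) (z : R[i]) : R[i] :=
  (expR (complex.Re z) * cos (complex.Im z)) +i*
  (expR (complex.Re z) * sin (complex.Im z)).

(* N ^ z for a positive integer N, with the real logarithm of N. *)
Definition natcpow (R : realType) (N : nat) (z : R[i]) : R[i] :=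
  cexp (z * (ln (N%:R : R))%:C).

(* Euler's limit  Gamma(z) = lim_N  N! N^z / (z (z+1) ... (z+N)), which
   converges at every complex z that is not a nonpositive integer; at the poles
   every late term is x / 0 = 0, so the value there is a meaningless 0. *)
Definition Gamma (R : realType) (z : R[i]) : R[i] :=
  lim ((N`!%:R * natcpow N z / \prod_(0 <= j < N.+1) (z + j%:R) : R[i]^o)
         @[N --> \oo]).

(* H_n^(s); only natural exponents s are needed. *)
Definition gharm (R : realType) (s n : nat) : R[i] :=
  \sum_(1 <= j < n.+1) (j%:R ^+ s)^-1.

Definition Gamma_quot (R : realType) (x s : R[i]) : R[i]^o :=
  Gamma (x + 1) * Gamma s / Gamma (x + s + 1).

(* Main.v *)
(** With [x = n + y] and [y] small, [Gamma (x+1) Gamma s / Gamma (x+s+1)] is the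
    Newton series [sum_k (-1)^k binom(x, k) / (s + k)].  Indeed Euler's limits
    combine to [N! prod_(j <= N) (x+s+1+j) / (prod (x+1+j) prod (s+j))]; expanding
    this in partial fractions in [s] gives the terms of the series weighted by
    factors of modulus at most 1 that tend to 1, plus a constant that tends to 0,
    and Tannery's theorem applies.
    As polynomials in [y], the binomial coefficients have coefficient majorants
    whose quotients by [k+1] telescope to a convergent series, so that the series
    may be differentiated twice in [y] at [0], and then [m] times in [s].  Applying
    [d^2/dx^2 - 2 H_n d/dx] to [binom(x, k)] at [x = n] produces the bracket of
    harmonic numbers, up to sign, for [k <= n], and the summand of the left-hand
    side for [k > n]. *)
Require Import Defs.
From HB Require Import structures.
From mathcomp Require Import all_boot all_order all_algebra complex.
From mathcomp Require Import all_classical all_reals all_analysis.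
From mathcomp Require Import ring lra zify.
Import Order.TTheory GRing.Theory Num.Theory.
Set Implicit Arguments. Unset Strict Implicit. Unset Printing Implicit Defensive.
Local Open Scope ring_scope.
Local Open Scope complex_scope.
Local Open Scope classical_set_scope.
Import Normc.

(** * The real-valued modulus on [R[i]] *)

Section ComplexModulus.
Variable R : realType.
Implicit Types (z w : R[i]) (x y : R).

Lemma normc_ge0 z : 0 <= normc z.
Proof. by case: z => a b; rewrite /normc sqrtr_ge0. Qed.

Lemma normrcE z : `|z| = (normc z)%:C.
Proof. by []. Qed.

Lemma normc_real x : normc x%:C = `|x|.
Proof. by rewrite /normc /= expr0n /= addr0 sqrtr_sqr. Qed.

Lemma normc_nat n : normc (n%:R : R[i]) = n%:R.
Proof. by rewrite -(rmorph_nat (real_complex R)) normc_real ger0_norm. Qed.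

Lemma normc_mulrn z n : normc (z *+ n) = normc z * n%:R.
Proof. by rewrite -[z *+ n]mulr_natr normcM normc_nat. Qed.

Lemma normcX z n : normc (z ^+ n) = normc z ^+ n.
Proof. by elim: n => [|n IH]; rewrite ?expr0 ?normc1 // !exprS normcM IH. Qed.

Lemma normc_gt0 z : z != 0 -> 0 < normc z.
Proof.
move=> z0; rewrite lt_neqAle normc_ge0 andbT eq_sym.
by apply: contra z0 => /eqP/eq0_normc ->.
Qed.

Lemma le_normcB z w : normc (z - w) <= normc z + normc w.
Proof. by rewrite -[normc w]normcN le_normcD. Qed.

Lemma normc_distC z w : normc (z - w) = normc (w - z).
Proof. by rewrite -normcN opprB. Qed.

Lemma normc_dist_tri (v z w : R[i]) : normc (z - w) <= normc (z - v) + normc (v - w).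
Proof. by apply: le_trans (le_normcD _ _); rewrite addrA subrK. Qed.

Lemma normc_sum (I : Type) (r : seq I) (P : pred I) (F : I -> R[i]) :
  normc (\sum_(i <- r | P i) F i) <= \sum_(i <- r | P i) normc (F i).
Proof.
elim/big_ind2: _ => [|a b c d h1 h2|i _]; rewrite ?normc0 //.
exact: le_trans (le_normcD _ _) (lerD h1 h2).
Qed.

Lemma normc_prod (I : Type) (r : seq I) (P : pred I) (F : I -> R[i]) :
  normc (\prod_(i <- r | P i) F i) = \prod_(i <- r | P i) normc (F i).
Proof. by elim/big_rec2: _ => [|i a b _ <-]; rewrite ?normc1 // normcM. Qed.

Lemma Re_le_normc z : `|complex.Re z| <= normc z.
Proof.
case: z => a b /=; rewrite -sqrtr_sqr ler_wsqrtr //; have := sqr_ge0 b; lra.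
Qed.

Lemma Im_le_normc z : `|complex.Im z| <= normc z.
Proof.
case: z => a b /=; rewrite -sqrtr_sqr ler_wsqrtr //; have := sqr_ge0 a; lra.
Qed.

Lemma normc_le_ReIm z : normc z <= `|complex.Re z| + `|complex.Im z|.
Proof.
have -> : z = (complex.Re z)%:C + (0 +i* 1) * (complex.Im z)%:C.
  by case: z => a b; simpc.
apply: le_trans (le_normcD _ _) _.
rewrite normcM !normc_real.
have -> : normc (0 +i* 1 : R[i]) = 1.
  by rewrite /normc /= expr0n /= expr1n add0r sqrtr1.
by case: z => a b; simpc.
Qed.

End ComplexModulus.

(** * Complex limits, absolutely convergent series and Tannery's theorem *)

Section ComplexLimits.
Variable R : realType.
Implicit Types (u v : nat -> R[i]) (l : R[i]).

Definition ccvg u l : Prop := (u n : R[i]^o) @[n --> \oo] --> (l : R[i]^o).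

Lemma ccvgP u l : ccvg u l <->
  (forall e : R, 0 < e -> exists N, forall n, (N <= n)%N -> normc (u n - l) < e).
Proof.
split=> [/cvgrPdist_lt h e e0|h].
  have /h[N _ hN] : 0 < e%:C by rewrite ltcR.
  exists N => n Nn; have := hN n Nn.
  by rewrite /= normrcE ltcR normc_distC.
(* In the partial order of [R[i]] a positive element has imaginary part 0, so the tolerance is a
   real number. *)
apply/cvgrPdist_lt => -[e f]; rewrite ltcE /= => /andP[/eqP -> e0].
have [N hN] := h _ e0; exists N => // n Nn /=.
have := hN _ Nn; rewrite normc_distC -ltcR; exact.
Qed.

Lemma ccvg_unique u l l' : ccvg u l -> ccvg u l' -> l = l'.
Proof. by move=> h h'; exact: (cvg_unique _ h h'). Qed.

Lemma ccvg_lim u l : ccvg u l -> lim ((u n : R[i]^o) @[n --> \oo]) = l.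
Proof. by move=> h; apply: cvg_lim => //; exact: norm_hausdorff. Qed.

Lemma ccvg_cst l : ccvg (fun=> l) l.
Proof. exact: cvg_cst. Qed.

Lemma ccvgD u v l l' : ccvg u l -> ccvg v l' -> ccvg (fun n => u n + v n) (l + l').
Proof. exact: cvgD. Qed.

Lemma ccvgM u v l l' : ccvg u l -> ccvg v l' -> ccvg (fun n => u n * v n) (l * l').
Proof. exact: cvgM. Qed.

Lemma ccvgMl c u l : ccvg u l -> ccvg (fun n => c * u n) (c * l).
Proof. exact/ccvgM/ccvg_cst. Qed.

Lemma ccvgB u v l l' : ccvg u l -> ccvg v l' -> ccvg (fun n => u n - v n) (l - l').
Proof. exact: cvgB. Qed.

Lemma ccvgV u l : l != 0 -> ccvg u l -> ccvg (fun n => (u n)^-1) l^-1.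
Proof. exact: cvgV. Qed.

Lemma ccvg_eq (N : nat) u v l :
  (forall n, (N <= n)%N -> u n = v n) -> ccvg u l -> ccvg v l.
Proof.
move=> uv /ccvgP h; apply/ccvgP => e /h[M hM]; exists (maxn N M) => n.
by rewrite geq_max => /andP[Nn Mn]; rewrite -uv //; exact: hM.
Qed.

Lemma ccvg_shift N u l : ccvg (fun n => u (n + N)%N) l <-> ccvg u l.
Proof.
split=> /ccvgP h; apply/ccvgP => e /h[M hM].
  exists (M + N)%N => n Mn; rewrite -(@subnK N n); last by lia.
  by apply: hM; lia.
by exists M => n Mn; apply: hM; lia.
Qed.

Lemma ccvg_norm_le u l (B : R) : ccvg u l -> (forall n, normc (u n) <= B) ->
  normc l <= B.
Proof.
move=> /ccvgP h hB; apply/ler_addgt0Pr => e /h[N /(_ N (leqnn N))].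
have := normc_dist_tri (u N) l 0; rewrite !subr0 normc_distC.
have := hB N; lra.
Qed.

(** For nonnegative terms this is summability; as a bound on partial sums it can be compared
    termwise and rescaled without naming a limit. *)
Definition bounded_series (a : nat -> R) :=
  exists B : R, forall N, \sum_(k < N) a k <= B.

Lemma real_bounded_series_cvg (a : nat -> R) (B : R) :
    (forall k, 0 <= a k) -> (forall N, \sum_(k < N) a k <= B) ->
  exists l : R, forall e : R, 0 < e ->
    exists N, forall n, (N <= n)%N -> `|\sum_(k < n) a k - l| < e.
Proof.
move=> a0 aB.
pose S n := \sum_(k < n) a k.
have ndS : nondecreasing_seq S.
  apply/nondecreasing_seqP => n; rewrite /S big_ord_recr /=.
  by have := a0 n; lra.
have ubS : has_ubound (range S) by exists B => _ [n _ <-]; exact: aB.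
exists (lim (S @ \oo)) => e e0.
have /cvgrPdist_lt/(_ e e0)[N _ hN] := nondecreasing_is_cvgn ndS ubS.
by exists N => n Nn; rewrite distrC; exact: hN.
Qed.

(** Writing [a = (|a| + a) - |a|] gives a difference of two series with nonnegative terms and
    bounded partial sums. *)
Lemma real_abs_series_cvg (a : nat -> R) : bounded_series (fun k => `|a k|) ->
  exists l : R, forall e : R, 0 < e ->
    exists N, forall n, (N <= n)%N -> `|\sum_(k < n) a k - l| < e.
Proof.
move=> [B aB].
have [k|N|l1 h1] := @real_bounded_series_cvg (fun k => `|a k| + a k) (2 * B).
- by have := ler_norm (- a k); rewrite normrN; lra.
- have : \sum_(k < N) (`|a k| + a k) <= \sum_(k < N) (2 * `|a k|).
    by apply: ler_sum => k _; have := ler_norm (a k); lra.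
  rewrite -mulr_sumr => /le_trans; apply.
  by have := aB N; lra.
have [k|l2 h2] := @real_bounded_series_cvg (fun k => `|a k|) B _ aB; first exact: normr_ge0.
exists (l1 - l2) => e e0.
have e2 : 0 < e / 2 by lra.
have [N1 hN1] := h1 _ e2; have [N2 hN2] := h2 _ e2.
exists (maxn N1 N2) => n; rewrite geq_max => /andP[/hN1 H1 /hN2 H2].
move: H1; rewrite big_split /= => H1.
set s := \sum_(k < n) a k in H1 *; set t := \sum_(k < n) `|a k| in H1 H2.
have -> : s - (l1 - l2) = (t + s - l1) - (t - l2) by lra.
by apply: le_lt_trans (ler_normB _ _) _; lra.
Qed.

Lemma series_ccvg (u : nat -> R[i]) : bounded_series (fun k => normc (u k)) ->
  exists l, ccvg (fun N => \sum_(k < N) u k) l.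
Proof.
move=> [B uB].
have [|a ha] := @real_abs_series_cvg (fun k => complex.Re (u k)).
  by exists B => N; apply: le_trans (uB N); apply: ler_sum => k _; exact: Re_le_normc.
have [|b hb] := @real_abs_series_cvg (fun k => complex.Im (u k)).
  by exists B => N; apply: le_trans (uB N); apply: ler_sum => k _; exact: Im_le_normc.
exists (a +i* b); apply/ccvgP => e e0.
have e2 : 0 < e / 2 by lra.
have [N1 hN1] := ha _ e2; have [N2 hN2] := hb _ e2.
exists (maxn N1 N2) => n; rewrite geq_max => /andP[/hN1 H1 /hN2 H2].
have E : \sum_(k < n) u k =
    (\sum_(k < n) complex.Re (u k)) +i* (\sum_(k < n) complex.Im (u k)).
  elim: n {H1 H2} => [|n IH]; first by rewrite !big_ord0.
  by rewrite !big_ord_recr /= IH; case: (u n) => c d; simpc.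
apply: le_lt_trans (normc_le_ReIm _) _.
by rewrite E; simpc => /=; lra.
Qed.

Lemma bounded_series_le (a b : nat -> R) : (forall k, a k <= b k) ->
  bounded_series b -> bounded_series a.
Proof.
by move=> ab [B hB]; exists B => N; apply: le_trans (hB N); apply: ler_sum.
Qed.

Lemma bounded_seriesZ (c : R) (a : nat -> R) : 0 <= c -> bounded_series a ->
  bounded_series (fun k => c * a k).
Proof.
move=> c0 [B hB]; exists (c * B) => N.
by rewrite -mulr_sumr ler_wpM2l.
Qed.

(** Dominated convergence for sums whose length grows with the parameter. Beyond a fixed [K] both
    sums are controlled by the tail of [M]; the first [K] terms converge one by one. *)
Lemma tannery (b : nat -> nat -> R[i]) (c : nat -> R[i]) (M : nat -> R) l :
    (forall N k, normc (b N k) <= M k) -> bounded_series M ->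
    (forall k, ccvg (b^~ k) (c k)) ->
    ccvg (fun N => \sum_(k < N) c k) l ->
  ccvg (fun N => \sum_(k < N) b N k) l.
Proof.
move=> bM sM bc cl.
have M0 k : 0 <= M k by exact: le_trans (normc_ge0 _) (bM 0%N k).
have cM k : normc (c k) <= M k by exact: ccvg_norm_le (bc k) (bM^~ k).
have [B hB] := sM.
have [L hL] := real_bounded_series_cvg M0 hB.
apply/ccvgP => e e0.
(* Partial sums of [M] within [e / 8] of their limit make tails at most [e / 4]. The final estimate
   adds two tails, the head below [e / 4] and the distance to [l] below [e / 8]. *)
have e8 : 0 < e / 8 by lra.
have [K hK] := hL _ e8.
have tail n : (K <= n)%N -> \sum_(K <= k < n) M k <= e / 4.
  move=> Kn; have := hK _ Kn; have := hK _ (leqnn K).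
  rewrite -!(big_mkord predT M) (big_cat_nat (leq0n K) Kn) /=.
  rewrite !ltr_norml => /andP[h1 _] /andP[_ h2]; move: h1 h2; lra.
have [N2 hN2] : exists N, forall n, (N <= n)%N ->
    normc (\sum_(k < K) b n k - \sum_(k < K) c k) < e / 4.
  have /ccvgP/(_ (e / 4))[] : ccvg (fun n => \sum_(k < K) b n k) (\sum_(k < K) c k).
    elim: K {hK tail} => [|K IH].
      by under eq_fun do rewrite big_ord0; rewrite big_ord0; exact: ccvg_cst.
    under eq_fun do rewrite big_ord_recr; rewrite big_ord_recr /=.
    exact: ccvgD IH (bc K).
  - by lra.
  - by move=> N hN; exists N.
have /ccvgP/(_ _ e8)[N3 hN3] := cl.
exists (maxn K (maxn N2 N3)) => n; rewrite !geq_max => /and3P[Kn /hN2 H2 /hN3 H3].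
have T (d : nat -> R[i]) : (forall k, normc (d k) <= M k) ->
    normc (\sum_(k < n) d k - \sum_(k < K) d k) <= e / 4.
  move=> dM; rewrite -!(big_mkord predT d) (big_cat_nat (leq0n K) Kn) /=.
  rewrite addrAC subrr add0r.
  apply: le_trans (normc_sum _ _ _) _; apply: le_trans (tail _ Kn).
  exact: ler_sum.
have Tb := T _ (bM n); have Tc := T _ cM.
apply: le_lt_trans (normc_dist_tri (\sum_(k < n) c k) _ _) _.
apply: le_lt_trans (lerD (normc_dist_tri (\sum_(k < K) b n k) _ _) (lexx _)) _.
have := normc_dist_tri (\sum_(k < K) c k) (\sum_(k < K) b n k) (\sum_(k < n) c k).
rewrite [X in _ <= _ + X]normc_distC; lra.
Qed.

End ComplexLimits.
Arguments ccvg_cst {R} l _.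
Arguments ccvgMl {R} c {u l} _ _.
Arguments ccvg_eq {R} N {u v l} _ _ _.

(** * Complex derivatives from quadratic remainder bounds *)

Section Derivatives.
Variable R : realType.
Implicit Types (x h : R[i]).

(** After division by [h] the error of the difference quotient is at most [K * normc h], which tends
    to 0. *)
Lemma derive1_quad (F : R[i] -> R[i]^o) x (g : R[i]) (K d : R) : 0 < d ->
    (forall h, normc h < d ->
       normc (F (x + h) - F x - h * g) <= K * normc h ^+ 2) ->
  derive1 F x = g.
Proof.
move=> d0 H; apply: cvg_lim; first exact: norm_hausdorff.
apply/cvgrPdist_lt => -[e f]; rewrite ltcE /= => /andP[/eqP -> e0].
(* The sign of [K] is unknown; [K1] is a positive number above it by which [e] can be divided. *)
pose K1 := `|K| + 1.
have K1gt0 : 0 < K1 by rewrite /K1; have := normr_ge0 K; lra.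
pose r := Num.min d (e / K1).
have r0 : 0 < r by rewrite lt_min d0 divr_gt0.
apply/nbhs_ballP; exists r%:C; first by rewrite /= ltcR.
move=> h; rewrite /ball /= sub0r normrN normrcE ltcR lt_min => /andP[hd he] h0.
have nh := normc_gt0 h0.
suff : normc (g - h^-1 * (F (h + x) - F x)) < e by rewrite -ltcR; exact.
have -> : g - h^-1 * (F (h + x) - F x) = - (h^-1 * (F (x + h) - F x - h * g)).
  by rewrite [h + x]addrC; field.
rewrite normcN normcM normcV mulrC ltr_pdivrMr //.
apply: le_lt_trans (H _ hd) _.
rewrite expr2 mulrA ltr_pM2r //.
have : normc h * K1 < e by rewrite -ltr_pdivlMr.
apply: le_lt_trans; rewrite mulrC ler_wpM2l ?normc_ge0 //.
by rewrite /K1; have := ler_norm K; lra.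
Qed.

(** The remainders of the partial sums are bounded by [B * normc h ^+ 2], uniformly in the number of
    terms. This bound passes to the limit, so [derive1_quad] applies to the sum. *)
Lemma derive1_termwise (f g : nat -> R[i] -> R[i]) (M : nat -> R)
    (F : R[i] -> R[i]^o) x (G : R[i]) (d : R) : 0 < d -> bounded_series M ->
    (forall k h, normc h < d ->
       normc (f k (x + h) - f k x - h * g k x) <= M k * normc h ^+ 2) ->
    (forall h, normc h < d -> ccvg (fun N => \sum_(k < N) f k (x + h)) (F (x + h))) ->
    ccvg (fun N => \sum_(k < N) g k x) G ->
  derive1 F x = G.
Proof.
move=> d0 [B hB] fgM fF gG.
apply: (@derive1_quad _ _ _ B d d0) => h hd.
have F0 : ccvg (fun N => \sum_(k < N) f k x) (F x).
  by have := fF 0; rewrite addr0 normc0; apply.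
have L := ccvgB (ccvgB (fF _ hd) F0) (ccvgMl h gG).
apply: (@ccvg_norm_le _ _ (F (x + h) - F x - h * G) (B * normc h ^+ 2) L) => N.
rewrite -sumrB mulr_sumr -sumrB; apply: le_trans (normc_sum _ _ _) _.
have : \sum_(k < N) M k * normc h ^+ 2 <= B * normc h ^+ 2.
  by rewrite -mulr_suml ler_wpM2r // exprn_ge0 ?normc_ge0.
apply: le_trans; apply: ler_sum => k _; exact: fgM.
Qed.

End Derivatives.

(** * Coefficient majorants of polynomials and second-order Taylor bounds *)

Section PolynomialMajorants.
Variable R : realType.
Implicit Types (p : {poly R[i]}) (r B : R).

(** A bound on the weighted l1 norm of the coefficients at radius [r]. Quantifying over all
    truncations avoids any mention of [size p]. *)
Definition maj r p B := forall N, \sum_(i < N) normc p`_i * r ^+ i <= B.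

Lemma maj_const r (c : R[i]) : 0 <= r -> maj r c%:P (normc c).
Proof.
move=> r0 [|N]; first by rewrite big_ord0 normc_ge0.
rewrite big_ord_recl big1 => [|i _]; last by rewrite lift0 coefC normc0 mul0r.
by rewrite coefC expr0 mulr1 addr0.
Qed.

Lemma majZ r (c : R[i]) p B : maj r p B -> maj r (c *: p) (normc c * B).
Proof.
move=> h N; under eq_bigr do rewrite coefZ normcM -mulrA.
by rewrite -mulr_sumr ler_wpM2l // normc_ge0.
Qed.

(** The weighted norm is submultiplicative and the linear factor has norm [r + normc a]. *)
Lemma maj_mulXaddC r (a : R[i]) p B : 0 <= r -> maj r p B ->
  maj r (('X + a%:P) * p) ((r + normc a) * B).
Proof.
move=> r0 h N.
have B0 : 0 <= B by have := h 0%N; rewrite big_ord0.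
case: N => [|N]; first by rewrite big_ord0 mulr_ge0 // addr_ge0 // normc_ge0.
have cE i : (('X + a%:P) * p)`_i.+1 = p`_i + a * p`_i.+1.
  by rewrite mulrDl coefD coefXM /= coefCM.
have c0 : (('X + a%:P) * p)`_0 = a * p`_0.
  by rewrite mulrDl coefD coefXM /= coefCM add0r.
rewrite big_ord_recl /= c0.
apply: (@le_trans _ _ (r * (\sum_(i < N) normc p`_i * r ^+ i) +
   normc a * \sum_(i < N.+1) normc p`_i * r ^+ i)).
  rewrite [in X in _ <= X]big_ord_recl /= normcM mulrDr !mulr_sumr [leRHS]addrCA mulrA.
  rewrite lerD2l -big_split /=; apply: ler_sum => i _.
  rewrite /bump /= add1n cE.
  have := le_normcD (p`_i) (a * p`_i.+1).
  move=> /(@ler_wpM2r _ (r ^+ i.+1)) -/(_ (exprn_ge0 _ r0)) /le_trans; apply.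
  by rewrite normcM mulrDl exprS le_eqVlt; apply/orP; left; apply/eqP; ring.
rewrite mulrDl lerD // ler_wpM2l ?normc_ge0 //; exact: h.
Qed.

Lemma maj_horner r p B (y : R[i]) : normc y <= r -> maj r p B ->
  normc p.[y] <= B.
Proof.
move=> yr h; rewrite horner_coef; apply: le_trans (h (size p)).
apply: le_trans (normc_sum _ _ _) _; apply: ler_sum => i _.
rewrite normcM normcX ler_wpM2l ?normc_ge0 //.
by rewrite lerXn2r ?nnegrE ?normc_ge0 // (le_trans _ yr) ?normc_ge0.
Qed.

(** Halving the radius gains [2 ^- i], which absorbs the factor [i.+1] produced by
    differentiation. *)
Lemma maj_deriv r p B : 0 < r -> maj r p B -> maj (r / 2) p^`() (B / r).
Proof.
move=> r0 h N; rewrite ler_pdivlMr // mulr_suml; apply: le_trans (h N.+1).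
rewrite big_ord_recl; apply: ler_wpDl; first by rewrite expr0 mulr1 normc_ge0.
apply: ler_sum => i _; rewrite lift0 coef_deriv normc_mulrn.
have hi : (i.+1%:R : R) <= 2 ^+ i by rewrite -natrX ler_nat ltn_expl.
rewrite exprS expr_div_n -!mulrA ler_wpM2l ?normc_ge0 //.
have ri : 0 <= r ^+ i by rewrite exprn_ge0 // ltW.
have -> : i.+1%:R * (r ^+ i * ((2 ^+ i)^-1 * r)) = (r * r ^+ i) * (i.+1%:R / 2 ^+ i) by ring.
rewrite -[leRHS]mulr1 ler_wpM2l ?mulr_ge0 ?(ltW r0) //.
by rewrite ler_pdivrMr ?mul1r // exprn_gt0.
Qed.

(** Induction on [i]: the next remainder is [y + h] times the previous one plus [h ^+ 2] times the
    derivative of [y ^+ i], matching Pascal's rule for ['C(i.+1, 2)]. The factor [r ^+ 2] on the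
    left replaces the exponent [i - 2], which fails for small [i]. *)
Lemma exprn_taylor2 (y h : R[i]) (r : R) (i : nat) :
    normc y <= r -> normc (y + h) <= r ->
  r ^+ 2 * normc ((y + h) ^+ i - y ^+ i - h * (y ^+ i.-1 *+ i)) <=
    normc h ^+ 2 * ('C(i, 2)%:R * r ^+ i).
Proof.
move=> yr yhr.
have r0 : 0 <= r by exact: le_trans (normc_ge0 _) yr.
elim: i => [|i IH].
  by rewrite !expr0 subrr mulr0n mulr0 subrr normc0 bin0n mul0r !mulr0.
have -> : (y + h) ^+ i.+1 - y ^+ i.+1 - h * (y ^+ i.+1.-1 *+ i.+1) =
    (y + h) * ((y + h) ^+ i - y ^+ i - h * (y ^+ i.-1 *+ i))
    + h ^+ 2 * (y ^+ i.-1 *+ i).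
  case: i {IH} => [|i] /=; first by rewrite !expr0 !expr1; ring.
  by rewrite !exprS; ring.
have ri : 0 <= r ^+ i by exact: exprn_ge0.
apply: le_trans (ler_wpM2l (exprn_ge0 _ r0) (le_normcD _ _)) _.
rewrite !normcM mulrDr binS bin1 natrD mulrDl mulrDr; apply: lerD.
  rewrite mulrCA.
  apply: le_trans (ler_wpM2r (mulr_ge0 (exprn_ge0 2 r0) (normc_ge0 _)) yhr) _.
  apply: le_trans (ler_wpM2l r0 IH) _.
  by rewrite [r ^+ i.+1]exprS le_eqVlt; apply/orP; left; apply/eqP; ring.
rewrite -expr2 mulrCA ler_wpM2l ?exprn_ge0 ?normc_ge0 //.
rewrite normc_mulrn; case: i {IH ri} => [|i]; first by rewrite !mulr0 mul0r.
rewrite normcX [leRHS]mulrC mulrA ler_wpM2r //.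
rewrite !exprS -!mulrA mul1r !ler_wpM2l //.
by rewrite lerXn2r ?nnegrE ?normc_ge0.
Qed.

Lemma bin2_le_exp2 i : ('C(i, 2) <= 2 ^ i)%N.
Proof.
elim: i => // i IH; have := ltn_expl i (isT : (1 < 2)%N).
by rewrite binS bin1 expnS; lia.
Qed.

(** Each monomial is estimated at radius [r / 2]: the resulting [2 ^- i] absorbs ['C(i, 2)], and
    [(r / 2) ^- 2] supplies the constant [4 / r ^+ 2]. *)
Lemma poly_taylor2 r p B (y h : R[i]) : 0 < r -> maj r p B ->
    normc y <= r / 2 -> normc (y + h) <= r / 2 ->
  normc (p.[y + h] - p.[y] - h * p^`().[y]) <= 4 / r ^+ 2 * B * normc h ^+ 2.
Proof.
move=> r0 hp yr yhr.
have -> : p.[y + h] - p.[y] - h * p^`().[y] =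
    \sum_(i < size p) p`_i * ((y + h) ^+ i - y ^+ i - h * (y ^+ i.-1 *+ i)).
  rewrite (@horner_coef_wide _ (size p) p^`()); last first.
    by rewrite (leq_trans (size_poly _ _)) // leq_pred.
  have -> : \sum_(i < size p) p^`()`_i * y ^+ i =
      \sum_(i < size p) p`_i * (y ^+ i.-1 *+ i).
    case E : (size p) => [|s]; first by rewrite !big_ord0.
    rewrite big_ord_recr [RHS]big_ord_recl /= coef_deriv nth_default ?E //.
    rewrite mul0rn mul0r mulr0n mulr0 addr0 add0r; apply: eq_bigr => i _.
    by rewrite /bump add1n coef_deriv mulrnAl mulrnAr.
  rewrite !horner_coef mulr_sumr -!sumrB; apply: eq_bigr => i _; ring.
apply: le_trans (normc_sum _ _ _) _.
have hb : \sum_(i < size p) normc p`_i * r ^+ i * (4 / r ^+ 2 * normc h ^+ 2) <=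
   4 / r ^+ 2 * B * normc h ^+ 2.
  rewrite -mulr_suml [leRHS]mulrAC [leRHS]mulrC ler_wpM2r //.
  by rewrite mulr_ge0 ?exprn_ge0 ?normc_ge0 // divr_ge0 // exprn_ge0 // ltW.
apply: le_trans hb; apply: ler_sum => i _.
rewrite normcM -mulrA ler_wpM2l ?normc_ge0 //.
have := exprn_taylor2 i yr yhr.
have r20 : 0 < (r / 2) ^+ 2 by rewrite exprn_gt0 // divr_gt0.
rewrite -ler_pdivlMl // => /le_trans; apply.
have hC : ('C(i, 2)%:R : R) <= 2 ^+ i.
  by rewrite -natrX ler_nat bin2_le_exp2.
have rn := gt_eqF r0.
have -> : (r / 2) ^- 2 * (normc h ^+ 2 * ('C(i, 2)%:R * (r / 2) ^+ i)) =
   (r ^+ i * (4 / r ^+ 2 * normc h ^+ 2)) * ('C(i, 2)%:R / 2 ^+ i).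
  rewrite !expr_div_n; field.
  by rewrite rn expf_neq0.
rewrite -[leRHS]mulr1 ler_wpM2l //.
  rewrite !mulr_ge0 ?exprn_ge0 ?normc_ge0 // ?invr_ge0 ?exprn_ge0 ?(ltW r0) //.
by rewrite ler_pdivrMr ?mul1r // exprn_gt0.
Qed.

End PolynomialMajorants.

(** * Elementary estimates for the exponential, real and complex *)

Section ComplexExponential.
Variable R : realType.
Implicit Types (z w : R[i]) (a b : R).

(** The mean value theorem from 0 towards a point of either sign; applied repeatedly to sine, cosine
    and [expR], it yields the first- and second-order bounds that follow. *)
Lemma MVT0 (f df : R -> R) b : (forall x : R, is_derive x 1 f (df x)) ->
  exists2 c, `|c| <= `|b| & f b - f 0 = df c * b.
Proof.
move=> fdf.
have cf x y : {within `[x, y], continuous f}.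
  by apply: derivable_within_continuous => t _; exact: ex_derive.
have [b0|b0] := leP 0 b.
  have [c] := MVT_segment b0 (fun x _ => fdf x) (cf 0 b).
  rewrite in_itv /= subr0 => /andP[c0 cb] ->; exists c => //.
  by rewrite !ger0_norm.
have [c] := MVT_segment (ltW b0) (fun x _ => fdf x) (cf b 0).
rewrite in_itv /= sub0r => /andP[bc c0] h; exists c; last by lra.
by rewrite !ler0_norm ?(ltW b0) // lerN2.
Qed.

Lemma normr_sin_le b : `|sin b| <= `|b|.
Proof.
have [c _] := MVT0 b (@is_derive_sin R); rewrite sin0 subr0 => ->.
by rewrite normrM ler_piMl // ler_norml cos_geN1 cos_le1.
Qed.

Lemma cosB1_le b : `|cos b - 1| <= b ^+ 2.
Proof.
have [c cb] := MVT0 b (@is_derive_cos R); rewrite cos0 => ->.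
rewrite normrM normrN -real_normK ?num_real // expr2 ler_wpM2r //.
exact: le_trans (normr_sin_le c) cb.
Qed.

Lemma cosB1_le1 b : `|cos b - 1| <= `|b|.
Proof.
have [c cb] := MVT0 b (@is_derive_cos R); rewrite cos0 => ->.
by rewrite normrM normrN ler_piMl // ler_norml sin_geN1 sin_le1.
Qed.

Lemma sinB_le b : `|sin b - b| <= b ^+ 2.
Proof.
have [c cb] := MVT0 b (@is_derive_sin R); rewrite sin0 subr0 => ->.
have -> : cos c * b - b = (cos c - 1) * b by ring.
rewrite normrM -real_normK ?num_real // expr2 ler_wpM2r //.
exact: le_trans (cosB1_le1 c) cb.
Qed.

Lemma expRB1_le a : `|expR a - 1| <= expR `|a| * `|a|.
Proof.
have [c ca] := MVT0 a (@is_derive_expR R); rewrite expR0 => ->.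
rewrite normrM ler_wpM2r // ger0_norm ?expR_ge0 // ler_expR.
exact: le_trans (ler_norm c) ca.
Qed.

Lemma expRB1D_le a : `|expR a - 1 - a| <= expR `|a| * a ^+ 2.
Proof.
have [c ca] := MVT0 a (@is_derive_expR R); rewrite expR0 => ->.
have -> : expR c * a - a = (expR c - 1) * a by ring.
rewrite normrM -[a ^+ 2]real_normK ?num_real // expr2 mulrA ler_wpM2r //.
apply: le_trans (expRB1_le c) _.
by rewrite ler_pM ?expR_ge0 // ler_expR.
Qed.

Lemma cexpD z w : cexp (z + w) = cexp z * cexp w.
Proof.
case: z w => a b [c d]; rewrite /cexp /= expRD cosD sinD; simpc.
by congr (_ +i* _); ring.
Qed.

Lemma cexp0 : cexp (0 : R[i]) = 1.
Proof. by rewrite /cexp /= expR0 cos0 sin0 mulr1 mulr0. Qed.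

Lemma cexpN_mul z : cexp (- z) * cexp z = 1.
Proof. by rewrite -cexpD addNr cexp0. Qed.

Lemma cexp_neq0 z : cexp z != 0.
Proof.
apply/eqP => h; have := cexpN_mul z; rewrite h mulr0 => /esym/eqP.
by rewrite oner_eq0.
Qed.

(** For [w = a + ib] the real and imaginary parts of the remainder split into four real pieces, each
    at most [expR W * normc w ^+ 2]. The separate bound [W] lets the constant stay fixed while [w]
    varies. *)
Lemma cexp_taylor2 w (W : R) : normc w <= W ->
  normc (cexp w - 1 - w) <= 4 * expR W * normc w ^+ 2.
Proof.
move=> wW; set e := expR W; set r := normc w.
have r0 : 0 <= r by exact: normc_ge0.
have aw : `|complex.Re w| <= r := Re_le_normc w.
have bw : `|complex.Im w| <= r := Im_le_normc w.
apply: le_trans (normc_le_ReIm _) _.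
case: w wW @r r0 aw bw => a b wW r r0 /= aw bw; rewrite !(subr0, oppr0, addr0).
have e1 : 1 <= e.
  by rewrite /e -expR0 ler_expR (le_trans _ wW).
have ea : expR `|a| <= e by rewrite ler_expR; exact: le_trans aw wW.
have ea' : `|expR a| <= e.
  rewrite ger0_norm ?expR_ge0 //; apply: le_trans ea.
  by rewrite ler_expR ler_norm.
have a2 : a ^+ 2 <= r ^+ 2 by rewrite -real_normK ?num_real // lerXn2r.
have b2 : b ^+ 2 <= r ^+ 2 by rewrite -real_normK ?num_real // lerXn2r.
have r2 : 0 <= r ^+ 2 by exact: exprn_ge0.
have H1 : `|expR a - 1 - a| <= e * r ^+ 2.
  by apply: le_trans (expRB1D_le a) _; rewrite ler_pM ?expR_ge0 ?sqr_ge0.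
have H2 : `|expR a * (cos b - 1)| <= e * r ^+ 2.
  by rewrite normrM ler_pM // (le_trans (cosB1_le b)).
have H3 : `|(expR a - 1) * sin b| <= e * r ^+ 2.
  rewrite normrM expr2 mulrA ler_pM //; last exact: le_trans (normr_sin_le b) bw.
  by apply: le_trans (expRB1_le a) _; rewrite ler_pM ?expR_ge0.
have H4 : `|sin b - b| <= e * r ^+ 2.
  apply: le_trans (sinB_le b) _; apply: le_trans b2 _.
  by rewrite ler_peMl.
have -> : expR a * cos b - 1 - a = (expR a - 1 - a) + expR a * (cos b - 1) by ring.
have -> : expR a * sin b - b = (expR a - 1) * sin b + (sin b - b) by ring.
have := ler_normD (expR a - 1 - a) (expR a * (cos b - 1)).
have := ler_normD ((expR a - 1) * sin b) (sin b - b).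
lra.
Qed.

Lemma real_complexV_nat (n : nat) : (n%:R^-1 : R)%:C = (n%:R : R[i])^-1.
Proof. by rewrite -(rmorph_nat (real_complex R)) -fmorphV. Qed.

Lemma real_complexB a b : (a - b)%:C = a%:C - b%:C.
Proof. by simpc. Qed.

Lemma natcpowD (N : nat) z w : natcpow N (z + w) = natcpow N z * natcpow N w.
Proof. by rewrite /natcpow mulrDl cexpD. Qed.

End ComplexExponential.

(** * Convergence of Euler's product for Gamma and the resulting limit for the beta quotient *)

Section EulerLimit.
Variable R : realType.
Implicit Types (z s h : R[i]).

Definition nonpole z := forall j : nat, z <> - j%:R.

Lemma nonpole_neq0 z j : nonpole z -> z + j%:R != 0.
Proof. by move=> hz; apply/eqP => /eqP; rewrite addr_eq0 => /eqP; exact: hz. Qed.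

Lemma nonpole_addn z j : nonpole z -> nonpole (z + j%:R).
Proof.
move=> hz k /eqP; rewrite -subr_eq0 opprK -addrA -natrD => /eqP h.
by have := nonpole_neq0 (j + k) hz; rewrite h eqxx.
Qed.

(** For [k] above [2 * normc z + 1] the triangle inequality gives at least half of [k.+1%:R]; the
    finitely many smaller [k] contribute a positive minimum. *)
Lemma nonpole_lower z : nonpole z ->
  exists2 c : R, 0 < c & forall k : nat, c * k.+1%:R <= normc (z + k%:R).
Proof.
move=> hz.
have fin K : exists2 c : R, 0 < c &
    forall k, (k < K)%N -> c * k.+1%:R <= normc (z + k%:R).
  elim: K => [|K [c c0 hc]]; first by exists 1.
  pose c' := normc (z + K%:R) / K.+1%:R.
  have c'0 : 0 < c' by rewrite divr_gt0 ?ltr0Sn // normc_gt0 // nonpole_neq0.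
  exists (Num.min c c'); first by rewrite lt_min c0.
  move=> k; rewrite ltnS leq_eqVlt => /predU1P[->|kK].
    by rewrite -ler_pdivlMr ?ltr0Sn // ge_min lexx orbT.
  apply: le_trans (hc _ kK).
  by rewrite ler_wpM2r // ge_min lexx.
pose K := Num.bound (2 * normc z + 1).
have hK : 2 * normc z + 1 < K%:R.
  by apply: archi_boundP; have := normc_ge0 z; lra.
have [c c0 hc] := fin K.
exists (Num.min c (1 / 2)); first by rewrite lt_min c0 /=; lra.
move=> k; have [kK|Kk] := ltnP k K.
  by apply: le_trans (hc _ kK); rewrite ler_wpM2r // ge_min lexx.
have hk : (K%:R : R) <= k%:R by rewrite ler_nat.
have := normc_dist_tri (- z) k%:R 0.
rewrite !subr0 opprK normcN normc_nat addrC [_ + z]addrC.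
have : Num.min c (1 / 2) * k.+1%:R <= 1 / 2 * k.+1%:R :> R.
  by rewrite ler_wpM2r // ge_min lexx orbT.
rewrite -[k.+1]addn1 natrD; lra.
Qed.

(** A perturbation below [c / 2] costs at most half of [c * k.+1%:R]. One constant thus serves a
    whole disc, as differentiation at [z] requires. *)
Lemma nonpole_lower_near z : nonpole z ->
  exists c d : R, [/\ 0 < c, 0 < d & forall h, normc h < d ->
    forall k : nat, c * k.+1%:R <= normc (z + h + k%:R)].
Proof.
move=> /nonpole_lower[c c0 hc]; exists (c / 2), (c / 2); split; try lra.
move=> h hd k; have := hc k.
have := normc_dist_tri (- h) (z + k%:R) 0.
rewrite !subr0 opprK normcN [z + k%:R + h]addrAC.
have : c / 2 <= c / 2 * k.+1%:R by rewrite ler_peMr ?ler1n //; lra.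
lra.
Qed.

Lemma lower_nonpole z (c : R) : 0 < c ->
  (forall k : nat, c * k.+1%:R <= normc (z + k%:R)) -> nonpole z.
Proof.
move=> c0 h j zj; have := h j; rewrite zj addNr normc0.
by apply/negP; rewrite -ltNge mulr_gt0 // ltr0Sn.
Qed.

(** The induction is on the sharper telescoping bound [2 - N.+1%:R^-1]. *)
Lemma bounded_series_inv_sqr : bounded_series (fun k => (k.+1%:R ^+ 2)^-1 : R).
Proof.
exists 2 => -[|N]; first by rewrite big_ord0.
suff : \sum_(k < N.+1) (k.+1%:R ^+ 2)^-1 <= 2 - N.+1%:R^-1 :> R.
  have : 0 <= N.+1%:R^-1 :> R by [].
  by move: (N.+1%:R^-1 : R) => t t0 h; apply: le_trans h _; lra.
elim: N => [|N IH]; first by rewrite big_ord1 expr1n invr1; lra.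
rewrite big_ord_recr /=; apply: le_trans (lerD IH (lexx _)) _.
rewrite -[N.+2%:R]natr1; set x : R := N.+1%:R.
have x0 : 0 < x by rewrite ltr0Sn.
rewrite -subr_ge0.
have -> : 2 - (x + 1)^-1 - (2 - x^-1 + ((x + 1) ^+ 2)^-1) = (x * (x + 1) ^+ 2)^-1.
  by field; rewrite !gt_eqF //; lra.
by rewrite invr_ge0 mulr_ge0 ?sqr_ge0 // ltW.
Qed.

(** An infinite product turned into a series: [1 + t <= expR t] bounds [u], hence the increments
    [u n * v n] are absolutely summable. *)
Lemma product_ccvg (u v : nat -> R[i]) :
    (forall n, u n.+1 = u n * (1 + v n)) -> bounded_series (fun n => normc (v n)) ->
  exists l, ccvg u l.
Proof.
move=> uv sv; have [B hB] := sv.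
have ub n : normc (u n) <= normc (u 0%N) * expR B.
  have : normc (u n) <= normc (u 0%N) * expR (\sum_(k < n) normc (v k)).
    elim: n => [|n IH]; first by rewrite big_ord0 expR0 mulr1.
    rewrite uv normcM big_ord_recr /= expRD mulrA ler_pM ?normc_ge0 //.
    apply: le_trans (expR_ge1Dx _).
    by apply: le_trans (le_normcD _ _) _; rewrite normc1.
  by move/le_trans; apply; rewrite ler_wpM2l ?normc_ge0 // ler_expR.
have [|l hl] := @series_ccvg R (fun n => u n * v n).
  apply: bounded_series_le (bounded_seriesZ _ sv); last first.
    by apply: mulr_ge0 (normc_ge0 (u 0%N)) (expR_ge0 B).
  by move=> k; rewrite normcM ler_wpM2r ?normc_ge0.
exists (u 0%N + l).
have L := ccvgD (ccvg_cst (u 0%N)) hl.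
apply: (ccvg_eq 0%N _ L) => n _.
elim: n => [|n IH]; first by rewrite big_ord0 addr0.
by rewrite big_ord_recr /= addrA IH uv mulrDr mulr1.
Qed.

Definition euler_seq z N : R[i] :=
  N`!%:R * natcpow N z / \prod_(0 <= j < N.+1) (z + j%:R).

Lemma prod_nonpole_neq0 z N : nonpole z -> \prod_(0 <= j < N) (z + j%:R) != 0.
Proof. by move=> hz; rewrite prodf_seq_neq0; apply/allP => j _; exact: nonpole_neq0. Qed.

Lemma euler_seq_neq0 z N : nonpole z -> euler_seq z N != 0.
Proof.
move=> hz; apply: mulf_neq0; last by rewrite invr_eq0 prod_nonpole_neq0.
apply: mulf_neq0; last exact: cexp_neq0.
by rewrite pnatr_eq0 -lt0n fact_gt0.
Qed.

Definition lnstep N : R := ln N.+2%:R - ln N.+1%:R.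

(** Both sides come from [ln (1 + t) <= t], at [t = - N.+2%:R^-1] and at [t = N.+1%:R^-1]. *)
Lemma lnstep_bounds N : N.+2%:R^-1 <= lnstep N <= N.+1%:R^-1.
Proof.
have p1 : 0 < N.+1%:R :> R by rewrite ltr0Sn.
have p2 : 0 < N.+2%:R :> R by rewrite ltr0Sn.
have E2 : N.+2%:R = N.+1%:R + 1 :> R by rewrite natr1.
have i2 : 0 < N.+2%:R^-1 :> R by rewrite invr_gt0.
have i1 : 0 < N.+1%:R^-1 :> R by rewrite invr_gt0.
apply/andP; split.
  have : ln (1 + - N.+2%:R^-1) <= - N.+2%:R^-1 :> R.
    apply: le_ln1Dx; rewrite ltrN2 invf_lt1 // E2; lra.
  have -> : 1 + - N.+2%:R^-1 = N.+1%:R / N.+2%:R :> R.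
    rewrite E2; move: (N.+1%:R : R) p1 => x x0.
    by field; rewrite gt_eqF //; lra.
  by rewrite ln_div ?posrE // lerNr opprB.
have : ln (1 + N.+1%:R^-1) <= N.+1%:R^-1 :> R.
  by apply: le_ln1Dx; apply: lt_trans i1; lra.
have -> : 1 + N.+1%:R^-1 = N.+2%:R / N.+1%:R :> R.
  by rewrite E2; move: (N.+1%:R : R) p1 => x x0; field; rewrite gt_eqF.
by rewrite ln_div ?posrE.
Qed.

Lemma natcpow_step z N : natcpow N.+2 z = natcpow N.+1 z * cexp (z * (lnstep N)%:C).
Proof.
rewrite /natcpow -cexpD -mulrDr; congr (cexp (_ * _)).
by rewrite -rmorphD /=; congr (_%:C); rewrite /lnstep; ring.
Qed.

(** The first summand of [K] is the Taylor error of the exponential; the second pays for replacing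
    the logarithmic step by [N.+2%:R^-1], an error of at most [N.+1%:R^-1 * N.+2%:R^-1]. *)
Lemma cexp_lnstep z : exists K : R, forall N,
  normc (cexp (z * (lnstep N)%:C) - 1 - z / N.+2%:R) <= K * (N.+1%:R ^+ 2)^-1.
Proof.
exists (4 * expR (normc z) * normc z ^+ 2 + normc z) => N.
have /andP[lo up] := lnstep_bounds N.
have p1 : 0 < N.+1%:R :> R by rewrite ltr0Sn.
have p2 : 0 < N.+2%:R :> R by rewrite ltr0Sn.
have E2 : N.+2%:R = N.+1%:R + 1 :> R by rewrite natr1.
have d0 : 0 <= lnstep N by apply: le_trans lo; rewrite invr_ge0 ltW.
have nw : normc (z * (lnstep N)%:C) = normc z * lnstep N.
  by rewrite normcM normc_real ger0_norm.
have up1 : lnstep N <= 1.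
  by apply: le_trans up _; rewrite invf_le1 // ler1n.
have /cexp_taylor2 : normc (z * (lnstep N)%:C) <= normc z.
  by rewrite nw ler_piMr ?normc_ge0.
rewrite nw => h.
apply: le_trans (normc_dist_tri (1 + z * (lnstep N)%:C - 1) _ _) _.
rewrite mulrDl; apply: lerD.
  have -> : cexp (z * (lnstep N)%:C) - 1 - (1 + z * (lnstep N)%:C - 1) =
     cexp (z * (lnstep N)%:C) - 1 - z * (lnstep N)%:C by ring.
  apply: le_trans h _; rewrite exprMn -!mulrA !ler_wpM2l ?expR_ge0 ?normc_ge0 //.
  by rewrite -exprVn lerXn2r ?nnegrE // invr_ge0 ltW.
have -> : 1 + z * (lnstep N)%:C - 1 - z / N.+2%:R =
    z * (lnstep N - N.+2%:R^-1)%:C.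
  by rewrite [(lnstep N - _)%:C]real_complexB real_complexV_nat; ring.
rewrite normcM normc_real ler_wpM2l ?normc_ge0 // ger0_norm ?subr_ge0 //.
apply: le_trans (lerB up (lexx _)) _.
have -> : N.+1%:R^-1 - N.+2%:R^-1 = N.+1%:R^-1 * N.+2%:R^-1 :> R.
  rewrite E2; move: (N.+1%:R : R) p1 => x x0.
  by field; rewrite !gt_eqF //; lra.
rewrite -exprVn expr2 ler_wpM2l ?invr_ge0 ?(ltW p1) //.
by rewrite lef_pV2 ?posrE // E2; lra.
Qed.

(** The ratio of consecutive terms in the form asked for by [product_ccvg]: a bounded factor times
    the quadratically small quantity of [cexp_lnstep]. The recursion starts at index 1, where the
    logarithm is genuine. *)
Lemma euler_seqS z N : nonpole z -> euler_seq z N.+2 =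
  euler_seq z N.+1 * (1 + (N.+2%:R / (z + N.+2%:R) *
    (cexp (z * (lnstep N)%:C) - 1 - z / N.+2%:R))).
Proof.
move=> hz; rewrite /euler_seq natcpow_step factS natrM big_nat_recr //=.
have hP := prod_nonpole_neq0 N.+2 hz.
have hN := nonpole_neq0 N.+2 hz.
have n0 : (N.+2%:R : R[i]) != 0 by rewrite pnatr_eq0.
move: (N.+2%:R) (\prod_(0 <= j < N.+2) _) (N.+1`!%:R) n0 hN hP => x P f n0 hN hP.
by field; rewrite hP hN n0.
Qed.

(** The reciprocals satisfy a recursion of the same kind, with [- z] in the exponential. Their
    convergence is what keeps the limit of [euler_seq] away from 0. *)
Lemma euler_seq_inv_step z N : nonpole z -> (euler_seq z N.+2)^-1 =
  (euler_seq z N.+1)^-1 *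
   (1 + ((1 + z / N.+2%:R) * (cexp (- z * (lnstep N)%:C) - 1 - (- z) / N.+2%:R)
     - (z / N.+2%:R) ^+ 2)).
Proof.
move=> hz; rewrite euler_seqS // invfM; congr (_ * _).
have hN := nonpole_neq0 N.+2 hz.
have n0 : (N.+2%:R : R[i]) != 0 by rewrite pnatr_eq0.
have E := cexpN_mul (z * (lnstep N)%:C).
rewrite -mulNr in E.
have c0 := cexp_neq0 (z * (lnstep N)%:C).
have -> : cexp (- z * (lnstep N)%:C) = (cexp (z * (lnstep N)%:C))^-1.
  by apply: (mulIf c0); rewrite E mulVf.
move: (cexp _) (N.+2%:R) c0 n0 hN {E} => w x c0 n0 hN.
have -> : 1 + x / (z + x) * (w - 1 - z / x) = x * w / (z + x).
  by field; rewrite n0 hN.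
by field; rewrite n0 c0 hN.
Qed.

(** The sequence and its reciprocal both converge, and the product of the two limits is 1. *)
Lemma euler_seq_ccvg z : nonpole z -> exists2 l, ccvg (euler_seq z) l & l != 0.
Proof.
move=> hz.
have [c c0 hc] := nonpole_lower hz.
have [l hl] : exists l, ccvg (fun N => euler_seq z N.+1) l.
  have [K hK] := cexp_lnstep z.
  apply: (product_ccvg (fun n => euler_seqS n hz)).
  apply: bounded_series_le (bounded_seriesZ _ bounded_series_inv_sqr); last first.
    by apply: mulr_ge0 (normr_ge0 (c^-1)) (normr_ge0 K).
  move=> N; rewrite normcM normcM normcV normc_nat -[leRHS]mulrA.
  rewrite ler_pM //; rewrite ?mulr_ge0 ?invr_ge0 ?normc_ge0 //.
    rewrite ger0_norm ?invr_ge0 ?(ltW c0) // ler_pdivrMr; last exact/normc_gt0/nonpole_neq0.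
    rewrite ler_pdivlMl //; apply: le_trans (hc N.+2).
    by rewrite ler_wpM2l ?(ltW c0) // ler_nat.
  by apply: le_trans (hK N) _; rewrite ler_wpM2r ?ler_norm.
have [l' hl'] : exists l, ccvg (fun N => (euler_seq z N.+1)^-1) l.
  have [K hK] := cexp_lnstep (- z).
  apply: (product_ccvg (fun n => euler_seq_inv_step n hz)).
  apply: bounded_series_le (bounded_seriesZ _ bounded_series_inv_sqr); last first.
    by apply: addr_ge0 (mulr_ge0 (addr_ge0 ler01 (normc_ge0 z)) (normr_ge0 K))
      (exprn_ge0 2 (normc_ge0 z)).
  move=> N; set q := (N.+1%:R ^+ 2)^-1.
  have q0 : 0 <= q by rewrite invr_ge0 exprn_ge0.
  have zN : normc (z / N.+2%:R) <= normc z.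
    by rewrite normcM normcV normc_nat ler_pdivrMr ?ltr0Sn // ler_peMr ?normc_ge0 // ler1n.
  have zN2 : normc (z / N.+2%:R) ^+ 2 <= normc z ^+ 2 * q.
    rewrite normcM normcV normc_nat exprMn ler_wpM2l ?sqr_ge0 // /q -exprVn.
    by rewrite lerXn2r ?nnegrE ?invr_ge0 // lef_pV2 ?posrE ?ltr0Sn // ler_nat.
  apply: le_trans (le_normcB _ _) _; rewrite normcX [leRHS]mulrDl lerD //.
  rewrite normcM -[leRHS]mulrA.
  apply: ler_pM; rewrite ?normc_ge0 //.
    by apply: le_trans (le_normcD _ _) _; rewrite normc1 lerD2l.
  by apply: le_trans (hK N) _; rewrite ler_wpM2r ?ler_norm.
exists l.
  apply: (ccvg_shift 1 _ _).1.
  by apply: (ccvg_eq 0%N _ hl) => n _; rewrite addn1.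
have : l * l' = 1.
  apply: ccvg_unique (ccvgM hl hl') _.
  apply: (ccvg_eq 0%N _ (ccvg_cst 1)) => n _.
  by rewrite divff // euler_seq_neq0.
by move=> h; apply/eqP => l0; move/eqP: h; rewrite l0 mul0r eq_sym oner_eq0.
Qed.

Lemma euler_seq_Gamma z : nonpole z -> ccvg (euler_seq z) (Gamma z).
Proof.
by move=> /euler_seq_ccvg[l hl _]; rewrite /Gamma (ccvg_lim hl).
Qed.

Lemma Gamma_neq0 z : nonpole z -> Gamma z != 0.
Proof.
by move=> /euler_seq_ccvg[l hl l0]; rewrite /Gamma (ccvg_lim hl).
Qed.

(** The Euler sequences at [x + 1] and [s] multiplied together and divided by the one at
    [x + s + 1]: the powers of [N] cancel and one factorial survives. *)
Definition beta_seq (x s : R[i]) N : R[i] :=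
  N`!%:R * \prod_(0 <= j < N.+1) (x + s + 1 + j%:R) /
  (\prod_(0 <= j < N.+1) (x + 1 + j%:R) * \prod_(0 <= j < N.+1) (s + j%:R)).

Lemma beta_seq_ccvg (x s : R[i]) : nonpole (x + 1) -> nonpole s ->
  nonpole (x + s + 1) -> ccvg (beta_seq x s) (Gamma_quot x s).
Proof.
move=> h1 h2 h3.
have := ccvgM (ccvgM (euler_seq_Gamma h1) (euler_seq_Gamma h2))
  (ccvgV (Gamma_neq0 h3) (euler_seq_Gamma h3)).
apply: (ccvg_eq 0%N) => N _.
rewrite /euler_seq /beta_seq.
have -> : natcpow N (x + s + 1) = natcpow N (x + 1) * natcpow N s.
  by rewrite -natcpowD addrAC.
have p1 := prod_nonpole_neq0 N.+1 h1.
have p2 := prod_nonpole_neq0 N.+1 h2.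
have p3 := prod_nonpole_neq0 N.+1 h3.
have e1 : natcpow N (x + 1) != 0 := cexp_neq0 _.
have e2 : natcpow N s != 0 := cexp_neq0 _.
have f0 : (N`!%:R : R[i]) != 0 by rewrite pnatr_eq0 -lt0n fact_gt0.
move: (natcpow N s) (natcpow N (x + 1)) (N`!%:R) e2 e1 f0 => a b c a0 b0 c0.
move: (\prod_(0 <= j < N.+1) (x + 1 + j%:R)) p1 => P1 p1.
move: (\prod_(0 <= j < N.+1) (s + j%:R)) p2 => P2 p2.
move: (\prod_(0 <= j < N.+1) (x + s + 1 + j%:R)) p3 => P3 p3.
by field; rewrite p1 p2 p3 a0 b0 c0.
Qed.

End EulerLimit.

(** * Lagrange interpolation and partial fractions with simple poles *)

Section PartialFractions.
Variable F : fieldType.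

(** The difference of the two sides has size at most [N] and vanishes at [N] distinct nodes. *)
Lemma lagrange_interpolation (N : nat) (z : nat -> F) (p : {poly F}) :
    (forall i j, (i < N)%N -> (j < N)%N -> z i = z j -> i = j) ->
    (size p <= N)%N ->
  p = \sum_(k < N) (p.[z k] / \prod_(j < N | j != k) (z k - z j)) *:
        \prod_(j < N | j != k) ('X - (z j)%:P).
Proof.
move=> zI sp; apply/eqP; rewrite -subr_eq0; apply/eqP.
set q := \sum_(k < N) _.
have sq : (size q <= N)%N.
  apply: leq_trans (size_sum _ _ _) _; apply/bigmax_leqP => k _.
  apply: leq_trans (size_scale_leq _ _) _.
  rewrite -big_filter size_prod_XsubC size_filter -sum1_count sum1_card cardC1 card_ord.
  by case: (N) k => [[]|].
apply: (@roots_geq_poly_eq0 _ _ [seq z i | i <- iota 0 N]).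
- rewrite all_map; apply/allP => i; rewrite mem_iota /= add0n => iN.
  rewrite /root hornerD hornerN subr_eq0 horner_sum; apply/eqP.
  rewrite (bigD1 (Ordinal iN)) //= [X in _ + X]big1 => [|k ki].
    rewrite addr0 hornerZ horner_prod.
    under [X in _ * X]eq_bigr do rewrite hornerXsubC.
    rewrite divfK //; apply/prodf_neq0 => j ji; rewrite subr_eq0.
    by apply: contra ji => /eqP/(zI _ _ iN (ltn_ord j)) h; apply/eqP/val_inj.
  rewrite hornerZ horner_prod [X in _ * X](bigD1 (Ordinal iN)) /=; last by rewrite eq_sym.
  by rewrite hornerXsubC subrr mul0r mulr0.
- rewrite map_inj_in_uniq ?iota_uniq // => i j.
  by rewrite !mem_iota !add0n => iN jN; exact: zI.
- rewrite size_map size_iota (leq_trans (size_polyD _ _)) // size_polyN.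
  by rewrite geq_max sp sq.
Qed.

Lemma partial_fractions (N : nat) (z : nat -> F) (p : {poly F}) (s : F) :
    (forall i j, (i < N)%N -> (j < N)%N -> z i = z j -> i = j) ->
    (size p <= N)%N -> (forall i, (i < N)%N -> s != z i) ->
  p.[s] / \prod_(j < N) (s - z j) =
  \sum_(k < N) p.[z k] / \prod_(j < N | j != k) (z k - z j) / (s - z k).
Proof.
move=> zI sp sz.
rewrite {1}(lagrange_interpolation zI sp) horner_sum mulr_suml.
apply: eq_bigr => k _; rewrite hornerZ horner_prod [\prod_(j < N) (s - z j)](bigD1 k) //=.
under [X in _ * X / _]eq_bigr do rewrite hornerXsubC.
have h : \prod_(j < N | j != k) (s - z j) != 0.
  by apply/prodf_neq0 => j _; rewrite subr_eq0 sz.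
by rewrite -!mulrA; congr (_ * (_ * _)); rewrite invfM mulrCA divff ?mulr1.
Qed.

Lemma size_monicB (p q : {poly F}) (N : nat) : p \is monic -> q \is monic ->
  size p = N.+1 -> size q = N.+1 -> (size (p - q)%R <= N)%N.
Proof.
move=> mp mq sp sq; apply/leq_sizeP => j; rewrite leq_eqVlt => /predU1P[<-|Nj].
  rewrite coefB; move/monicP: mp; move/monicP: mq.
  by rewrite !lead_coefE sp sq /= => -> ->; rewrite subrr.
by rewrite coefB !nth_default ?subrr // ?sp ?sq.
Qed.

End PartialFractions.

(** * Partial fractions of the finite beta quotients, and the limits of their ingredients *)

Section BetaPartialFractions.
Variable R : realType.
Implicit Types (x s y : R[i]).

Definition cbin x k : R[i] := \prod_(i < k) ((x - i%:R) / i.+1%:R).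

(** The factor by which the residue of [beta_seq x s N] at [s = - k%:R] differs from its limit
    [(-1) ^+ k * cbin x k]. *)
Definition bweight x N k : R[i] :=
  \prod_(i < k) ((N - i)%N%:R / (x + 1 + (N - i)%N%:R)).

Lemma prod_node (N k : nat) : (k <= N)%N ->
  \prod_(j < N.+1 | j != k :> nat) (- k%:R - - j%:R : R[i]) =
    (-1) ^+ k * (k`! * (N - k)`!)%:R.
Proof.
move=> kN; rewrite -(subnK kN) addnC addKn; move: (N - k)%N => d {kN N}.
elim: d => [|d IH].
  rewrite addn0 muln1 big_mkcond big_ord_recr /= eqxx mulr1.
  rewrite (eq_bigr (fun j : 'I_k => - k%:R - - j%:R)); last first.
    by move=> j _; rewrite ltn_eqF.
  elim: k => [|k IH]; first by rewrite big_ord0 mulr1.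
  rewrite big_ord_recl factS natrM exprS.
  have -> : \prod_(i < k) (- k.+1%:R - - (lift ord0 i)%:R : R[i]) =
     \prod_(i < k) (- k%:R - - i%:R).
    by apply: eq_bigr => i _; rewrite lift0 -!natr1; ring.
  by rewrite IH -[nat_of_ord ord0]/0%N; ring.
rewrite addnS big_mkcond big_ord_recr -big_mkcond IH /=.
rewrite ifT; last by rewrite neq_ltn; apply/orP; right; lia.
rewrite factS -addnS !natrM natrD; ring.
Qed.

(** Lowering the argument by [k] removes the top [k] factors of the product and inserts
    [x, x - 1, ..., x - k + 1] at the bottom. *)
Lemma prod_shift x (N k : nat) : (k <= N)%N ->
  \prod_(0 <= j < N.+1) (x + 1 + j%:R - k%:R) *
    \prod_(i < k) (x + 1 + (N - i)%N%:R) =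
  \prod_(0 <= j < N.+1) (x + 1 + j%:R) * \prod_(i < k) (x - i%:R).
Proof.
elim: k => [|k IH] kN.
  by rewrite !big_ord0; congr (_ * _); apply: eq_bigr => j _; rewrite subr0.
rewrite !big_ord_recr /= !mulrA -IH ?(ltnW kN) //.
rewrite mulrAC [RHS]mulrAC; congr (_ * _).
have -> : \prod_(0 <= j < N.+1) (x + 1 + j%:R - k.+1%:R) =
    (x - k%:R) * \prod_(0 <= j < N) (x + 1 + j%:R - k%:R).
  rewrite big_nat_recl //; congr (_ * _); first by rewrite -natr1; ring.
  by apply: eq_bigr => i _; rewrite -!natr1; ring.
rewrite big_nat_recr //= natrB ?(ltnW kN) //; ring.
Qed.

(** As polynomials in [s], the two products are monic of equal degree. The constant [c] is therefore
    split off, leaving a proper fraction; at the node [- k%:R] the subtracted [q 0] vanishes and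
    [prod_shift] evaluates the rest. *)
Lemma beta_partial_fractions x s N : nonpole (x + 1) -> nonpole s ->
  beta_seq x s N = N`!%:R / \prod_(0 <= j < N.+1) (x + 1 + j%:R) +
    \sum_(k < N.+1) (-1) ^+ k * cbin x k * bweight x N k / (s + k%:R).
Proof.
move=> hx hs; rewrite /beta_seq.
set P1 := \prod_(0 <= j < N.+1) (x + 1 + j%:R).
have P10 : P1 != 0 by exact: prod_nonpole_neq0.
pose c := N`!%:R / P1.
pose q a : {poly R[i]} := \prod_(j < N.+1) ('X - (- (a + j%:R))%:P).
have qE a t : (q a).[t] = \prod_(j < N.+1) (t + a + j%:R).
  rewrite horner_prod; apply: eq_bigr => j _.
  by rewrite hornerXsubC opprK addrA.
have sq a : size (q a) = N.+2.
  by rewrite size_prod_XsubC /index_enum -enumT size_enum_ord.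
have mq a : q a \is monic by exact: monic_prod_XsubC.
have sp : (size (c *: (q (x + 1) - q 0))%R <= N.+1)%N.
  by apply: leq_trans (size_scale_leq _ _) _; apply: size_monicB.
have zI i j : (i < N.+1)%N -> (j < N.+1)%N -> - i%:R = - j%:R :> R[i] -> i = j.
  by move=> _ _ /eqP; rewrite eqr_opp eqr_nat => /eqP.
have sz i : (i < N.+1)%N -> s != - i%:R by move=> _; apply/eqP/hs.
have := partial_fractions zI sp sz.
have P20 := prod_nonpole_neq0 N.+1 hs.
have E0 : \prod_(j < N.+1) (s - - j%:R) = \prod_(0 <= j < N.+1) (s + j%:R).
  by rewrite big_mkord; apply: eq_bigr => j _; rewrite opprK.
have E1 : (q 0).[s] = \prod_(0 <= j < N.+1) (s + j%:R).
  by rewrite qE big_mkord; apply: eq_bigr => j _; rewrite addr0.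
have E2 : (q (x + 1)).[s] = \prod_(0 <= j < N.+1) (x + s + 1 + j%:R).
  by rewrite qE big_mkord; apply: eq_bigr => j _; ring.
rewrite E0 hornerZ hornerD hornerN E1 E2 => H.
apply: (@etrans _ _ (c + c * (\prod_(0 <= j < N.+1) (x + s + 1 + j%:R) -
     \prod_(0 <= j < N.+1) (s + j%:R)) / \prod_(0 <= j < N.+1) (s + j%:R))).
  rewrite /c; move: (\prod_(0 <= j < N.+1) _) P20 => P2 P20.
  by field; rewrite P10 P20.
rewrite H; congr (_ + _); apply: eq_bigr => k _.
rewrite opprK; congr (_ / _).
have kN : (k <= N)%N by rewrite -ltnS.
have -> : \prod_(j < N.+1 | j != k) (- k%:R - - j%:R : R[i]) =
    (-1) ^+ k * (k`! * (N - k)`!)%:R by rewrite -prod_node.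
rewrite hornerZ hornerD hornerN !qE.
have -> : \prod_(j < N.+1) (- k%:R + 0 + j%:R : R[i]) = 0.
  by rewrite (bigD1 k) //= addr0 addNr mul0r.
have E3 : \prod_(j < N.+1) (- k%:R + (x + 1) + j%:R) =
    \prod_(0 <= j < N.+1) (x + 1 + j%:R - k%:R).
  by rewrite big_mkord; apply: eq_bigr => j _; ring.
have w0 : \prod_(i < k) (x + 1 + (N - i)%N%:R) != 0.
  by apply/prodf_neq0 => i _; exact: nonpole_neq0.
have := prod_shift x kN; rewrite -E3 -/P1 => /(canRL (mulfK w0)) ->.
rewrite /cbin /bweight !big_split /= !prodfV.
have -> : \prod_(i < k) (i.+1%:R : R[i]) = k`!%:R.
  by rewrite fact_prod big_add1 natr_prod big_mkord.
have fE : \prod_(i < k) ((N - i)%N%:R : R[i]) * (N - k)`!%:R = N`!%:R.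
  by rewrite -natr_prod -ffact_prod -natrM ffact_fact.
have f1 : (k`!%:R : R[i]) != 0 by rewrite pnatr_eq0 -lt0n fact_gt0.
have f2 : ((N - k)`!%:R : R[i]) != 0 by rewrite pnatr_eq0 -lt0n fact_gt0.
rewrite /c -fE natrM subr0.
have sg : ((-1) ^+ k : R[i])^-1 = (-1) ^+ k by rewrite -exprVn invrN invr1.
rewrite !invfM sg.
move: (\prod_(i < k) (x + 1 + (N - i)%N%:R)) w0 => w w0.
by field; rewrite P10 f1 f2 w0.
Qed.

Lemma nat_le_normc (z : R[i]) (a : nat) : 0 <= complex.Re z ->
  a%:R <= normc (z + a%:R).
Proof.
move=> z0; apply: le_trans (Re_le_normc _); apply: le_trans (ler_norm _).
rewrite -(rmorph_nat (real_complex R)); case: z z0 => u v /= u0.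
by rewrite lerDr.
Qed.

Lemma bweight_le1 x N k : 0 <= complex.Re (x + 1) -> normc (bweight x N k) <= 1.
Proof.
move=> x0; rewrite normc_prod; apply: prodr_ile1 => i _.
rewrite normc_ge0 /= normcM normcV normc_nat.
have := nat_le_normc (N - i) x0; set a := normc _.
(* A vanishing denominator makes the factor 0, by the convention for division by zero. *)
have [->|a0] := eqVneq a 0; first by rewrite invr0 mulr0.
rewrite ler_pdivrMr ?mul1r // lt_neqAle eq_sym a0; exact: normc_ge0.
Qed.

Lemma bweight_ccvg x k : 0 <= complex.Re (x + 1) -> nonpole (x + 1) ->
  ccvg (fun N => bweight x N k) 1.
Proof.
move=> x0 hx.
have L : ccvg (fun N : nat => (x + 1) / (x + 1 + N%:R)) 0.
  apply/ccvgP => e e0.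
  have [K hK] : exists K, normc (x + 1) / e < K%:R.
    exists (Num.bound (normc (x + 1) / e)); apply: archi_boundP.
    by rewrite divr_ge0 ?normc_ge0 // ltW.
  exists K => N KN; rewrite subr0 normcM normcV.
  rewrite ltr_pdivrMr; last exact/normc_gt0/nonpole_neq0.
  apply: lt_le_trans (ler_wpM2l (ltW e0) (nat_le_normc N x0)).
  rewrite mulrC -ltr_pdivrMr //; apply: lt_le_trans hK _.
  by rewrite ler_nat.
have L1 : ccvg (fun N : nat => N%:R / (x + 1 + N%:R)) 1.
  have := ccvgB (ccvg_cst 1) L; rewrite subr0 => L'.
  apply: (ccvg_eq 0%N _ L') => N _.
  by field; rewrite nonpole_neq0.
elim: k => [|k IH].
  by apply: (ccvg_eq 0%N _ (ccvg_cst 1)) => N _; rewrite /bweight big_ord0.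
have L2 : ccvg (fun N => (N - k)%N%:R / (x + 1 + (N - k)%N%:R)) 1.
  by apply: (ccvg_shift k _ _).1; apply: (ccvg_eq 0%N _ L1) => N _; rewrite addnK.
have := ccvgM IH L2; rewrite mulr1 => L3.
by apply: (ccvg_eq 0%N _ L3) => N _; rewrite /bweight big_ord_recr.
Qed.

(** The quantity [normc (c N) ^+ 2 * N.+1%:R] does not increase, because
    [b * (b + 1) <= (b + 1 / 2) ^+ 2] with [b = N.+1%:R]. Hence [c N] decays at least like the
    inverse square root of [N]. *)
Lemma beta_const_ccvg0 x : 1 / 2 <= complex.Re (x + 1) -> nonpole (x + 1) ->
  ccvg (fun N => N`!%:R / \prod_(0 <= j < N.+1) (x + 1 + j%:R)) 0.
Proof.
move=> x0 hx; pose c N : R[i] := N`!%:R / \prod_(0 <= j < N.+1) (x + 1 + j%:R).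
pose K := normc (c 0%N) ^+ 2.
have cK N : normc (c N) ^+ 2 * N.+1%:R <= K.
  elim: N => [|N IH]; first by rewrite mulr1.
  apply: le_trans IH.
  have -> : c N.+1 = c N * (N.+1%:R / (x + 1 + N.+1%:R)).
    rewrite /c factS natrM [in LHS]big_nat_recr //=.
    by rewrite invfM; ring.
  rewrite normcM exprMn -mulrA ler_wpM2l ?exprn_ge0 ?normc_ge0 //.
  rewrite normcM normcV normc_nat.
  have h : N.+1%:R + 1 / 2 <= normc (x + 1 + N.+1%:R).
    apply: le_trans (Re_le_normc _); apply: le_trans (ler_norm _).
    rewrite -(rmorph_nat (real_complex R)); case: (x + 1) x0 => u v /=; lra.
  rewrite exprMn exprVn -[N.+2%:R]natr1.
  move: (normc _) (N.+1%:R : R) (ltr0Sn R N) h => a b b0 h.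
  have a0 : 0 < a by lra.
  rewrite mulrAC ler_pdivrMr ?exprn_gt0 //.
  rewrite expr2 -!mulrA ler_pM2l // expr2; nra.
apply/ccvgP => e e0.
have e2 : 0 < e ^+ 2 by rewrite exprn_gt0.
have [K0 hK] : exists K0, K / e ^+ 2 < K0%:R.
  exists (Num.bound (K / e ^+ 2)); apply: archi_boundP.
  by rewrite divr_ge0 ?exprn_ge0 ?normc_ge0 // ltW.
exists K0 => N KN; rewrite subr0.
rewrite -(@ltr_pXn2r _ 2) ?nnegrE ?normc_ge0 ?(ltW e0) //.
have p : 0 < N.+1%:R :> R by rewrite ltr0Sn.
rewrite -(ltr_pM2r p); apply: le_lt_trans (cK N) _.
rewrite mulrC -ltr_pdivrMr //; apply: lt_le_trans hK _.
by rewrite ler_nat ltnW // ltnS.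
Qed.

End BetaPartialFractions.

(** * The Newton series of the beta quotient and its first two derivatives in [x] *)

Section NewtonSeries.
Variable R : realType.
Implicit Types (x s y h : R[i]) (n k : nat).

(* The binomial coefficient [(n + y) choose k] as a polynomial in [y]. *)
Fixpoint newton n k : {poly R[i]} :=
  if k is k'.+1 then
    k'.+1%:R^-1 *: (('X + (n%:R - k'%:R)%:P) * newton n k')
  else 1.

Lemma newton_horner n k y : (newton n k).[y] = cbin (n%:R + y) k.
Proof.
elim: k => [|k IH]; first by rewrite hornerE /cbin big_ord0.
by rewrite /= !hornerE IH /cbin big_ord_recr /=; ring.
Qed.

(** The product of the weighted norms, at radius 1/2, of the linear factors of [newton n k]. *)
Fixpoint newton_maj n k : R :=
  if k is k'.+1 then
    k'.+1%:R^-1 * ((1 / 2 + normc (n%:R - k'%:R : R[i])) * newton_maj n k')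
  else 1.

Lemma maj_newton n k : maj (1 / 2) (newton n k) (newton_maj n k).
Proof.
have r0 : 0 <= 1 / 2 :> R by lra.
elim: k => [|k IH] /=; first by have := maj_const 1 r0; rewrite normc1.
have <- : normc (k.+1%:R^-1 : R[i]) = k.+1%:R^-1 by rewrite normcV normc_nat.
exact/majZ/maj_mulXaddC.
Qed.

Lemma newton_maj_ge0 n k : 0 <= newton_maj n k.
Proof. by have := maj_newton n k 0; rewrite big_ord0. Qed.

Lemma bounded_series_shift n (a : nat -> R) : (forall k, 0 <= a k) ->
  bounded_series (fun k => a (n + k)%N) -> bounded_series a.
Proof.
move=> a0 [B hB]; exists (\sum_(k < n) a k + B) => N.
have : \sum_(k < n + N) a k <= \sum_(k < n) a k + B.
  by rewrite big_split_ord lerD2l; exact: hB.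
apply: le_trans; rewrite addnC big_split_ord /= lerDl.
by apply: sumr_ge0.
Qed.

(** From [k = n] on, passing to [k.+1] multiplies the majorant by [(k - n + 1/2) / (k + 1)]. Since
    1/2 is below 1, each term is at most twice the drop of the majorant, and the sum telescopes. *)
Lemma bounded_series_newton_maj n : bounded_series (fun k => newton_maj n k / k.+1%:R).
Proof.
apply: (@bounded_series_shift n); first by move=> k; rewrite divr_ge0 // newton_maj_ge0.
exists (2 * newton_maj n n) => N.
suff : \sum_(k < N) newton_maj n (n + k) / (n + k).+1%:R <=
    2 * newton_maj n n - 2 * newton_maj n (n + N).
  by move=> /le_trans; apply; have := newton_maj_ge0 n (n + N); lra.
elim: N => [|N IH]; first by rewrite big_ord0 addn0 subrr.
rewrite big_ord_recr /=; apply: le_trans (lerD IH (lexx _)) _.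
rewrite addnS /=.
have -> : normc (n%:R - (n + N)%:R : R[i]) = N%:R.
  by rewrite natrD opprD addrA subrr add0r normcN normc_nat.
have := newton_maj_ge0 n (n + N); move: (newton_maj n (n + N)) => t t0.
have E : (n + N).+1%:R = n%:R + N%:R + 1 :> R by rewrite -natr1 natrD.
have p0 : 0 < (n + N).+1%:R :> R by rewrite ltr0Sn.
rewrite -subr_ge0.
have -> : 2 * newton_maj n n -
    2 * ((n + N).+1%:R^-1 * ((1 / 2 + N%:R) * t)) -
    (2 * newton_maj n n - 2 * t + t / (n + N).+1%:R) =
    2 * n%:R * t / (n + N).+1%:R.
  rewrite E in p0 *; move: (n%:R : R) (N%:R : R) (newton_maj n n) p0 => a b m p0.
  by field; rewrite gt_eqF.
by rewrite divr_ge0 // ?mulr_ge0.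
Qed.

(** The conclusion has the shape of the convergence hypothesis, with [p k] replaced by its
    derivative; together with [maj_deriv] this allows iteration at the price of halving the
    radius. *)
Lemma derive1_poly_series (a : nat -> R[i]) (p : nat -> {poly R[i]})
    (B : nat -> R) (r d : R) (F : R[i] -> R[i]^o) (x y : R[i]) :
    0 < r -> d <= r / 2 -> (forall k, maj r (p k) (B k)) ->
    bounded_series (fun k => normc (a k) * B k) ->
    (forall t, normc t < d ->
       ccvg (fun N => \sum_(k < N) a k * (p k).[t]) (F (x + t))) ->
    normc y < d ->
  ccvg (fun N => \sum_(k < N) a k * (p k)^`().[y]) (derive1 F (x + y)).
Proof.
move=> r0 dr hp sB hF yd.
have [|G hG] := @series_ccvg R (fun k => a k * (p k)^`().[y]).
  have := @bounded_seriesZ R r^-1 _ _ sB; rewrite invr_ge0 => /(_ (ltW r0)).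
  apply: bounded_series_le => k; rewrite normcM mulrCA ler_wpM2l ?normc_ge0 // mulrC.
  apply: maj_horner (maj_deriv r0 (hp k)).
  exact: ltW (lt_le_trans yd dr).
suff -> : derive1 F (x + y) = G by [].
apply: (@derive1_termwise R (fun k z => a k * (p k).[z - x])
  (fun k z => a k * (p k)^`().[z - x]) (fun k => 4 / r ^+ 2 * (normc (a k) * B k))
  F (x + y) G (d - normc y)).
- by rewrite subr_gt0.
- by apply: bounded_seriesZ sB; rewrite divr_ge0 // exprn_ge0 // ltW.
- move=> k h hd.
  have -> : x + y + h - x = y + h by ring.
  have -> : x + y - x = y by ring.
  have -> : a k * (p k).[y + h] - a k * (p k).[y] - h * (a k * (p k)^`().[y]) =
     a k * ((p k).[y + h] - (p k).[y] - h * (p k)^`().[y]) by ring.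
  rewrite normcM.
  have -> : 4 / r ^+ 2 * (normc (a k) * B k) * normc h ^+ 2 =
     normc (a k) * (4 / r ^+ 2 * B k * normc h ^+ 2) by ring.
  rewrite ler_wpM2l ?normc_ge0 //; apply: poly_taylor2 => //; first by lra.
  by apply: le_trans (le_normcD _ _) _; lra.
- move=> h hd.
  have yhd : normc (y + h) < d by apply: le_lt_trans (le_normcD _ _) _; lra.
  have := hF _ yhd; rewrite addrA => L.
  apply: (ccvg_eq 0%N _ L) => N _; apply: eq_bigr => k _.
  by have -> : x + y + h - x = y + h by ring.
- by apply: (ccvg_eq 0%N _ hG) => N _; apply: eq_bigr => k _; rewrite addrAC subrr add0r.
Qed.

Definition ncoef s k : R[i] := (-1) ^+ k / (s + k%:R).

Lemma normc_sign k : normc ((-1) ^+ k : R[i]) = 1.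
Proof. by rewrite normcX normcN normc1 expr1n. Qed.

Lemma bounded_series_ncoef n s : nonpole s ->
  bounded_series (fun k => normc (ncoef s k) * newton_maj n k).
Proof.
move=> /nonpole_lower[c c0 hc].
have := @bounded_seriesZ R c^-1 _ _ (bounded_series_newton_maj n).
rewrite invr_ge0 => /(_ (ltW c0)); apply: bounded_series_le => k.
rewrite normcM normc_sign mul1r normcV [leRHS]mulrCA [leRHS]mulrC ler_wpM2r ?newton_maj_ge0 //.
have p0 : 0 < c * k.+1%:R by rewrite mulr_gt0.
have q0 : 0 < normc (s + k%:R) by exact: lt_le_trans p0 (hc k).
by rewrite -invfM lef_pV2 ?posrE.
Qed.

Lemma Re_gt0_nonpole (z : R[i]) : 0 < complex.Re z -> nonpole z.
Proof.
move=> z0 j zj; move: z0; rewrite zj -(rmorph_nat (real_complex R)) /=.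
by rewrite ltNge oppr_le0 ler0n.
Qed.

(** The bound on [y] gives [x + 1] real part at least 1/2, so the weights have modulus at most 1 and
    the constant of the partial fractions tends to 0. *)
Lemma newton_series n y s : normc y <= 1 / 2 -> nonpole s -> nonpole (s + y) ->
  ccvg (fun N => \sum_(k < N) ncoef s k * (newton n k).[y])
    (Gamma_quot (n%:R + y) s).
Proof.
move=> y2 hs hsy; set x := n%:R + y.
have Rex : 1 / 2 <= complex.Re (x + 1).
  have : - complex.Re y <= 1 / 2.
    by apply: le_trans y2; rewrite (le_trans _ (Re_le_normc y)) // -normrN ler_norm.
  have := ler0n R n; rewrite /x -(rmorph_nat (real_complex R)).
  by case: y {y2 hsy x} => u v /=; lra.
have Rex0 : 0 <= complex.Re (x + 1) by lra.
have hx : nonpole (x + 1) by apply: Re_gt0_nonpole; lra.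
have hxs : nonpole (x + s + 1).
  have -> : x + s + 1 = s + y + n.+1%:R by rewrite /x -natr1; ring.
  exact: nonpole_addn.
have sM := bounded_series_ncoef n hs.
have bM k : normc (ncoef s k * (newton n k).[y]) <= normc (ncoef s k) * newton_maj n k.
  rewrite normcM ler_wpM2l ?normc_ge0 //.
  exact: maj_horner (maj_newton n k).
have [|L hL] := @series_ccvg R (fun k => ncoef s k * (newton n k).[y]).
  exact: bounded_series_le sM.
(* The index [N.-1] fits the format of [tannery]: the partial fractions at level [N] have [N.+1]
   terms. *)
have T : ccvg (fun N => \sum_(k < N) ncoef s k * (newton n k).[y] * bweight x N.-1 k) L.
  apply: (@tannery _ (fun N k => ncoef s k * (newton n k).[y] * bweight x N.-1 k)
    _ _ _ _ sM _ hL) => [N k|k].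
    apply: le_trans (bM k); rewrite normcM ler_piMr ?normc_ge0 //.
    exact: bweight_le1.
  have := ccvgMl (ncoef s k * (newton n k).[y])
    ((ccvg_shift 1 (fun N => bweight x N.-1 k) 1).1 _).
  rewrite mulr1; apply.
  by apply: (ccvg_eq 0%N _ (bweight_ccvg k Rex0 hx)) => N _; rewrite addn1.
suff <- : L = Gamma_quot x s by [].
apply: ccvg_unique (beta_seq_ccvg hx hs hxs).
have := ccvgD (beta_const_ccvg0 Rex hx) ((ccvg_shift 1 _ _).2 T).
rewrite add0r => L'; apply: (ccvg_eq 0%N _ L') => N _.
rewrite beta_partial_fractions // addn1; congr (_ + _); apply: eq_bigr => k _.
by rewrite newton_horner -/x /ncoef /=; ring.
Qed.

Lemma Gamma_quot_derive n s : nonpole s ->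
  ccvg (fun N => \sum_(k < N) ncoef s k * (newton n k)`_1)
    (derive1n 1 (fun x => Gamma_quot x s) n%:R) /\
  ccvg (fun N => \sum_(k < N) ncoef s k * ((newton n k)`_2 *+ 2))
    (derive1n 2 (fun x => Gamma_quot x s) n%:R).
Proof.
move=> hs; have [c [d [c0 d0 hd]]] := nonpole_lower_near hs.
pose F x := Gamma_quot x s : R[i]^o.
have r0 : 0 < 1 / 2 :> R by lra.
have r20 : 0 < 1 / 2 / 2 :> R by lra.
have sM := bounded_series_ncoef n hs.
have sM2 : bounded_series (fun k => normc (ncoef s k) * (newton_maj n k / (1 / 2))).
  have := @bounded_seriesZ R 2 _ _ sM; rewrite ler0n => /(_ isT).
  apply: bounded_series_le => k.
  by rewrite le_eqVlt; apply/orP; left; apply/eqP; field.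
(* The bound [d] keeps [s + t] off the poles, and 1/4 is half of the radius 1/2 of the majorants. *)
have L0 t : normc t < Num.min d (1 / 2 / 2) ->
    ccvg (fun N => \sum_(k < N) ncoef s k * (newton n k).[t]) (F (n%:R + t)).
  rewrite lt_min => /andP[td t2]; apply: newton_series => //; first by lra.
  exact: lower_nonpole c0 (hd _ td).
have d1 : Num.min d (1 / 2 / 2) <= 1 / 2 / 2 by rewrite ge_min lexx orbT.
have L1 t := @derive1_poly_series _ _ _ _ _ F n%:R t r0 d1 (maj_newton n) sM L0.
(* The second differentiation starts from majorants at radius 1/4, so its disc shrinks to 1/8. *)
pose d' := Num.min d (1 / 2 / 2 / 2).
have d2 : d' <= 1 / 2 / 2 / 2 by rewrite ge_min lexx orbT.
have d'0 : 0 < d' by rewrite lt_min d0 /=; lra.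
have L1' t : normc t < d' ->
    ccvg (fun N => \sum_(k < N) ncoef s k * (newton n k)^`().[t]) (derive1 F (n%:R + t)).
  rewrite lt_min => /andP[td t2]; apply: L1; rewrite lt_min td /=; lra.
have L2 t := @derive1_poly_series _ _ _ _ _ _ n%:R t r20 d2
  (fun k => maj_deriv r0 (maj_newton n k)) sM2 L1'.
split.
  have := L1' 0; rewrite normc0 addr0 => /(_ d'0) L.
  apply: (ccvg_eq 0%N _ L) => N _; apply: eq_bigr => k _.
  by rewrite horner_coef0 coef_deriv mulr1n.
have := L2 0; rewrite normc0 addr0 => /(_ d'0) L.
apply: (ccvg_eq 0%N _ L) => N _; apply: eq_bigr => k _.
by rewrite horner_coef0 !coef_deriv mulr1n.
Qed.

(** * Low-order coefficients of the Newton polynomials in terms of harmonic numbers *)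

Lemma newton_coefS n k i : (newton n k.+1)`_i.+1 =
  ((n%:R - k%:R) * (newton n k)`_i.+1 + (newton n k)`_i) / k.+1%:R.
Proof. by rewrite /= coefZ mulrDl coefD coefXM coefCM /=; ring. Qed.

Lemma newton_coef0S n k : (newton n k.+1)`_0 =
  (n%:R - k%:R) * (newton n k)`_0 / k.+1%:R.
Proof. by rewrite /= coefZ mulrDl coefD coefXM coefCM /= add0r mulrC. Qed.

Local Notation H := (gharm R 1).
Local Notation H2 := (gharm R 2).

Lemma gharmS a k : gharm R a k.+1 = gharm R a k + (k.+1%:R ^+ a)^-1.
Proof. by rewrite /gharm big_nat_recr. Qed.

Lemma gharm0 a : gharm R a 0 = 0.
Proof. by rewrite /gharm big_geq. Qed.

(** For [k <= n] the polynomial is ['C(n, k)] times the product of [1 + y / (n - i)] over [i < k].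
    Its next coefficients are elementary symmetric functions of the [1 / (n - i)], given by power
    sums through [2 e_2 = e_1^2 - p_2]. *)
Lemma newton_coef_le n k : (k <= n)%N ->
  [/\ (newton n k)`_0 = 'C(n, k)%:R,
      (newton n k)`_1 = 'C(n, k)%:R * (H n - H (n - k)) &
      (newton n k)`_2 *+ 2 = 'C(n, k)%:R *
        ((H n - H (n - k)) ^+ 2 - (H2 n - H2 (n - k)))].
Proof.
elim: k => [|k IH] kn.
  by rewrite subn0 !subrr expr0n /= subrr !mulr0 bin0 !coefC /= mul0rn.
have {IH}[] := IH (ltnW kn).
have [m nE] : exists m, n = (k + m.+1)%N by exists (n - k.+1)%N; lia.
have -> : (n - k.+1 = m)%N by lia.
have -> : (n - k = m.+1)%N by lia.
have nk : n%:R - k%:R = m.+1%:R :> R[i] by rewrite nE natrD addrC addKr.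
have k0 : (k.+1%:R : R[i]) != 0 by rewrite pnatr_eq0.
have m0 : (m.+1%:R : R[i]) != 0 by rewrite pnatr_eq0.
have Ck : 'C(n, k.+1)%:R = m.+1%:R * 'C(n, k)%:R / k.+1%:R :> R[i].
  apply: (canRL (mulfK k0)); rewrite -!natrM mulnC mul_bin_left.
  by have -> : (n - k = m.+1)%N by lia.
rewrite !gharmS expr1 newton_coef0S !newton_coefS nk Ck.
move: (m.+1%:R : R[i]) (k.+1%:R : R[i]) ('C(n, k)%:R : R[i]) k0 m0 => a b C b0 a0.
move: (newton n k)`_0 (newton n k)`_1 (newton n k)`_2 => c0 c1 c2 -> -> E.
have {E} -> : c2 = C * ((H n - (H m + a^-1)) ^+ 2 - (H2 n - (H2 m + (a ^+ 2)^-1))) / 2.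
  by rewrite -E; field.
by split; field; rewrite ?a0 ?b0.
Qed.

(** Beyond [n] the factor with index [n] is [y] itself, so the constant term vanishes. The factors
    [y + 1, ..., y + n] and [y - 1, ..., y - j] contribute [H n] and [- H j] to the quadratic
    coefficient. *)
Lemma newton_coef_gt n j :
  let c := (-1) ^+ j / (j.+1%:R * 'C(n + j.+1, j.+1)%:R) in
  [/\ (newton n (n + j.+1))`_0 = 0,
      (newton n (n + j.+1))`_1 = c &
      (newton n (n + j.+1))`_2 = c * (H n - H j)].
Proof.
elim: j => [|j [IH0 IH1 IH2]] /=.
  have [h0 h1 _] := newton_coef_le (leqnn n).
  rewrite addn1 newton_coef0S !newton_coefS subrr !mul0r !add0r h0 h1 subnn gharm0.
  by rewrite binn bin1 expr0 !mul1r subr0 mulrC.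
rewrite addnS newton_coef0S !newton_coefS IH0 IH1 IH2 mulr0 mul0r.
have -> : n%:R - (n + j.+1)%:R = - j.+1%:R :> R[i].
  by rewrite natrD opprD addrA subrr add0r.
have B : j.+2%:R * 'C((n + j.+1).+1, j.+2)%:R =
    (n + j.+1).+1%:R * 'C(n + j.+1, j.+1)%:R :> R[i].
  by rewrite -!natrM mul_bin_diag.
have j0 : (j.+1%:R : R[i]) != 0 by rewrite pnatr_eq0.
have b0 : ((n + j.+1).+1%:R : R[i]) != 0 by rewrite pnatr_eq0.
have c0 : ('C(n + j.+1, j.+1)%:R : R[i]) != 0.
  by rewrite pnatr_eq0 -lt0n bin_gt0 leq_addl.
rewrite {}B gharmS expr1 exprS.
move: (j.+1%:R : R[i]) ((n + j.+1).+1%:R : R[i]) ('C(n + j.+1, j.+1)%:R : R[i]) j0 b0 c0.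
move=> a b C a0 b0 c0.
by split => //; field; rewrite a0 b0 c0.
Qed.

End NewtonSeries.

(** * Repeated differentiation in [s] of series with simple poles at the nonpositive integers *)

Section StieltjesSeries.
Variable R : realType.
Implicit Types (s u h : R[i]).

(* With [a = (u + h)^-1] and [b = u^-1] one has [a - b = - h * a * b], so the
   remainder reduces to the second-order expansion of [a ^+ q] at [b]. *)
Lemma expVn_taylor2 u h (r : R) q : 0 < r -> u != 0 -> u + h != 0 ->
    normc u^-1 <= r -> normc (u + h)^-1 <= r ->
  normc ((u + h) ^- q - u ^- q - h * - (q%:R * u ^- q.+1)) <=
    'C(q.+1, 2)%:R * r ^+ q.+2 * normc h ^+ 2.
Proof.
move=> r0 u0 uh0 ur uhr.
pose a := (u + h)^-1; pose b := u^-1.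
have ab : b + (a - b) = a by ring.
have abE : a - b = - (h * (a * b)) by rewrite /a /b; field; rewrite u0 uh0.
have T : r ^+ 2 * normc (a ^+ q - b ^+ q - (a - b) * (b ^+ q.-1 *+ q)) <=
    normc (a - b) ^+ 2 * ('C(q, 2)%:R * r ^+ q).
  by have := @exprn_taylor2 R b (a - b) r q; rewrite ab; apply.
have nab : normc (a - b) <= normc h * r ^+ 2.
  by rewrite abE normcN !normcM ler_wpM2l ?normc_ge0 // expr2 ler_pM ?normc_ge0.
have h0 := normc_ge0 h; have r2 : 0 < r ^+ 2 by rewrite exprn_gt0.
have rq : 0 <= r ^+ q by rewrite exprn_ge0 // ltW.
have {}T : normc (a ^+ q - b ^+ q - (a - b) * (b ^+ q.-1 *+ q)) <=
    'C(q, 2)%:R * r ^+ q.+2 * normc h ^+ 2.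
  rewrite -(ler_pM2l r2); apply: le_trans T _.
  have -> : r ^+ 2 * ('C(q, 2)%:R * r ^+ q.+2 * normc h ^+ 2) =
     (normc h * r ^+ 2) ^+ 2 * ('C(q, 2)%:R * r ^+ q).
    by rewrite [r ^+ q.+2]exprSr [r ^+ q.+1]exprSr; ring.
  rewrite ler_wpM2r ?mulr_ge0 //.
  by rewrite lerXn2r ?nnegrE ?normc_ge0 ?mulr_ge0 // ltW.
rewrite -!exprVn -/a -/b.
have -> : a ^+ q - b ^+ q - h * - (q%:R * b ^+ q.+1) =
    (a ^+ q - b ^+ q - (a - b) * (b ^+ q.-1 *+ q)) + h ^+ 2 * (q%:R * (a * b ^+ q.+1)).
  case: q {T rq} => [|q]; first by rewrite !mulr0n; ring.
  have E : (a - b) * (b ^+ q *+ q.+1) = - (h * (q.+1%:R * (a * b ^+ q.+1))).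
    by rewrite abE exprS -mulr_natl; ring.
  have E' : h ^+ 2 * (q.+1%:R * (a * b ^+ q.+2)) =
     - (h * (q.+1%:R * ((a - b) * b ^+ q.+1))).
    by rewrite abE [b ^+ q.+2]exprS; ring.
  by rewrite E E' [b ^+ q.+2]exprS; ring.
apply: le_trans (le_normcD _ _) _.
(* Pascal's rule ['C(q.+1, 2) = 'C(q, 2) + q] distributes the bound over the two pieces. *)
rewrite binS bin1 natrD [_ * r ^+ q.+2]mulrDl [leRHS]mulrDl lerD // normcM normcX mulrC.
rewrite ler_wpM2r ?exprn_ge0 // !normcM normc_nat normcX ler_wpM2l // [r ^+ q.+2]exprS.
rewrite ler_pM ?normc_ge0 ?exprn_ge0 ?normc_ge0 //.
by rewrite lerXn2r ?nnegrE ?normc_ge0 // ltW.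
Qed.

(** Only one factor [k.+1%:R^-1] is retained from the power; it is the weight against which the
    coefficients [e k] are summable. *)
Lemma inv_exp_le (c : R) s (k q : nat) : 0 < c ->
    c * k.+1%:R <= normc (s + k%:R) ->
  normc (s + k%:R)^-1 <= (c * k.+1%:R)^-1 /\
  (c * k.+1%:R)^-1 ^+ q.+1 <= c^-1 ^+ q.+1 / k.+1%:R.
Proof.
move=> c0 hc; have p0 : 0 < c * k.+1%:R by rewrite mulr_gt0.
split; first by rewrite normcV lef_pV2 ?posrE // (lt_le_trans p0).
rewrite invfM exprMn ler_wpM2l ?exprn_ge0 ?invr_ge0 ?(ltW c0) //.
rewrite exprS ler_piMr ?invr_ge0 // exprn_ile1 ?invr_ge0 //.
by rewrite invf_le1 ?ler1n // ltr0Sn.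
Qed.

(** Induction on [m] with termwise differentiation. The induction hypothesis holds at every nonpole,
    hence on a disc around [s], where [nonpole_lower_near] makes the remainder bounds uniform. *)
Lemma stieltjes_derive (e : nat -> R[i]) (F : R[i] -> R[i]^o) :
    bounded_series (fun k => normc (e k) / k.+1%:R) ->
    (forall s, nonpole s -> ccvg (fun N => \sum_(k < N) e k / (s + k%:R)) (F s)) ->
  forall m s, nonpole s ->
    ccvg (fun N => \sum_(k < N) (-1) ^+ m * m`!%:R * (e k / (s + k%:R) ^+ m.+1))
      (derive1n m F s).
Proof.
move=> se hF; elim=> [|m IH] s hs.
  apply: (ccvg_eq 0%N _ (hF s hs)) => N _; apply: eq_bigr => k _.
  by rewrite expr0 !mul1r expr1.
have [c [d [c0 d0 hd]]] := nonpole_lower_near hs.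
have hc k : c * k.+1%:R <= normc (s + k%:R).
  by have := hd 0; rewrite normc0 addr0; apply.
pose g k z : R[i] := (-1) ^+ m.+1 * m.+1`!%:R * (e k / (z + k%:R) ^+ m.+2).
pose f k z : R[i] := (-1) ^+ m * m`!%:R * (e k / (z + k%:R) ^+ m.+1).
have [|G hG] := @series_ccvg R (g^~ s).
  have := @bounded_seriesZ R (m.+1`!%:R * c^-1 ^+ m.+2) _ _ se.
  rewrite mulr_ge0 ?exprn_ge0 ?invr_ge0 ?(ltW c0) // => /(_ isT).
  apply: bounded_series_le => k; have [h1 h2] := inv_exp_le m.+1 c0 (hc k).
  rewrite /g !normcM normc_sign mul1r normc_nat -mulrA ler_wpM2l //.
  rewrite mulrCA ler_wpM2l ?normc_ge0 //; apply: le_trans h2.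
  by rewrite -exprVn normcX lerXn2r ?nnegrE ?normc_ge0 // invr_ge0 mulr_ge0 // ltW.
suff -> : derive1n m.+1 F s = G by [].
rewrite derive1nS.
apply: (@derive1_termwise R f g
  (fun k => (m`!%:R * 'C(m.+2, 2)%:R * c^-1 ^+ m.+3) * (normc (e k) / k.+1%:R))
  (derive1n m F) s G d d0 _ _ _ hG).
- apply: bounded_seriesZ se; apply: mulr_ge0; first by rewrite mulr_ge0 ?ler0n.
  by rewrite exprn_ge0 // invr_ge0 ltW.
- move=> k h hhd.
  have p0 : 0 < c * k.+1%:R by rewrite mulr_gt0.
  have [h1 h2] := inv_exp_le m.+2 c0 (hc k).
  have [h3 _] := inv_exp_le m.+2 c0 (hd _ hhd k).
  have nz : s + k%:R != 0 by exact: nonpole_neq0.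
  have nzh : s + k%:R + h != 0.
    by rewrite addrAC; apply: nonpole_neq0; exact: lower_nonpole c0 (hd _ hhd).
  have {}h3 : normc (s + k%:R + h)^-1 <= (c * k.+1%:R)^-1 by rewrite addrAC.
  have r0 : 0 < (c * k.+1%:R)^-1 by rewrite invr_gt0.
  have := expVn_taylor2 m.+1 r0 nz nzh h1 h3.
  have -> : f k (s + h) - f k s - h * g k s = (-1) ^+ m * m`!%:R * e k *
     ((s + k%:R + h) ^- m.+1 - (s + k%:R) ^- m.+1 -
       h * - (m.+1%:R * (s + k%:R) ^- m.+2)).
    rewrite /f /g factS natrM [(-1) ^+ m.+1]exprS [s + h + _]addrAC.
    move: ((s + k%:R + h) ^- m.+1) ((s + k%:R) ^- m.+1) ((s + k%:R) ^- m.+2).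
    by move=> A B C; ring.
  rewrite [in X in _ -> X]normcM => T.
  apply: le_trans (ler_wpM2l (normc_ge0 _) T) _.
  rewrite !normcM normc_sign mul1r normc_nat.
  have -> : m`!%:R * normc (e k) *
      ('C(m.+2, 2)%:R * (c * k.+1%:R)^-1 ^+ m.+3 * normc h ^+ 2) =
     m`!%:R * 'C(m.+2, 2)%:R * normc (e k) * normc h ^+ 2 * (c * k.+1%:R)^-1 ^+ m.+3.
    by ring.
  have -> : m`!%:R * 'C(m.+2, 2)%:R * c^-1 ^+ m.+3 * (normc (e k) / k.+1%:R) * normc h ^+ 2 =
     m`!%:R * 'C(m.+2, 2)%:R * normc (e k) * normc h ^+ 2 * (c^-1 ^+ m.+3 / k.+1%:R).
    by ring.
  by rewrite ler_wpM2l // !mulr_ge0 ?exprn_ge0 ?normc_ge0.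
- by move=> h hhd; apply: IH; exact: lower_nonpole c0 (hd _ hhd).
Qed.

End StieltjesSeries.

(** * Comparison of coefficients and assembly of the identity *)

Theorem theorem3p9 (R : realType) (p : R[i]) (m n : nat)
    (hp : forall j : nat, p <> - j%:R) :
  (\sum_(1 <= k < N)
      ((-1) ^+ n * gharm R 1 k.-1
       / (k%:R * (p + n%:R + k%:R) ^+ m.+1 * 'C(n + k, k)%:R)) : R[i]^o)
    @[N --> \oo] -->
  (2^-1 * (\sum_(0 <= k < n.+1)
      (-1) ^+ k / (p + k%:R) ^+ m.+1 * 'C(n, k)%:R
      * (gharm R 1 n ^+ 2 + gharm R 2 n
         - gharm R 1 (n - k) ^+ 2 - gharm R 2 (n - k)))
   + (-1) ^+ m / (2 * m`!%:R)
     * derive1n m (fun s : R[i] =>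
         (derive1n 2 (fun x : R[i] => Gamma_quot x s) n%:R
          - 2 * gharm R 1 n
            * derive1n 1 (fun x : R[i] => Gamma_quot x s) n%:R) : R[i]^o) p
   : R[i]^o).
Proof.
set F := fun s : R[i] => _.
(* The operator [d^2/dx^2 - 2 H_n d/dx] applied to the binomial coefficient [x] choose [k] at
   [x = n]. *)
pose c k := (newton R n k)`_2 *+ 2 - 2 * gharm R 1 n * (newton R n k)`_1.
have hF s : nonpole s -> ccvg (fun N => \sum_(k < N) ((-1) ^+ k * c k) / (s + k%:R)) (F s).
  move=> /(Gamma_quot_derive n)[L1 L2].
  have L := ccvgB L2 (ccvgMl (2 * gharm R 1 n) L1).
  apply: (ccvg_eq 0%N _ L) => N _; rewrite mulr_sumr -sumrB; apply: eq_bigr => k _.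
  by rewrite /ncoef /c; ring.
have sc : bounded_series (fun k => normc ((-1) ^+ k * c k) / k.+1%:R).
  have := @bounded_seriesZ R (8 + 4 * normc (gharm R 1 n)) _ _ (bounded_series_newton_maj R n).
  have Hn0 := normc_ge0 (gharm R 1 n).
  move=> h; apply: bounded_series_le (h _); last by lra.
  move=> k; rewrite normcM normc_sign mul1r mulrA ler_wpM2r ?invr_ge0 //.
  (* Three coefficients at radius 1/2 give the factor 2 for the linear and 4 for the quadratic one;
     hence the constant [8 + 4 * normc (gharm R 1 n)]. *)
  have := maj_newton R n k 3; rewrite !big_ord_recr big_ord0 /= add0r expr0 expr1.
  have := normc_ge0 (newton R n k)`_0; have := normc_ge0 (newton R n k)`_1.
  have := normc_ge0 (newton R n k)`_2.
  have := le_normcB ((newton R n k)`_2 *+ 2) (2 * gharm R 1 n * (newton R n k)`_1).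
  rewrite -/(c k) normc_mulrn !normcM normc_nat.
  rewrite -[(1 + 1)%R]/2%N => hc c2 c1 c0 hM.
  have a2 : normc (newton R n k)`_2 <= 4 * newton_maj R n k by lra.
  have a1 : normc (newton R n k)`_1 <= 2 * newton_maj R n k by lra.
  by have := ler_wpM2l Hn0 a1; lra.
have S := @stieltjes_derive R _ F sc hF m p hp.
pose t k : R[i] := 2^-1 * ((-1) ^+ k * c k / (p + k%:R) ^+ m.+1).
have f0 : (m`!%:R : R[i]) != 0 by rewrite pnatr_eq0 -lt0n fact_gt0.
have sg q : ((-1) ^+ q * (-1) ^+ q : R[i]) = 1 by rewrite -exprMn mulrNN mulr1 expr1n.
have {}S : ccvg (fun N => \sum_(k < N) t k)
    ((-1) ^+ m / (2 * m`!%:R) * derive1n m F p).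
  apply: (ccvg_eq 0%N _ (ccvgMl ((-1) ^+ m / (2 * m`!%:R)) S)) => N _.
  rewrite mulr_sumr; apply: eq_bigr => k _; rewrite /t.
  transitivity ((-1) ^+ m * (-1) ^+ m * (2^-1 * ((-1) ^+ k * c k / (p + k%:R) ^+ m.+1))).
    by field; rewrite f0 expf_neq0 // nonpole_neq0.
  by rewrite sg mul1r.
(* For [k <= n] the terms in [H_n H_{n-k}] cancel, and [c k] is minus ['C(n, k)] times the bracket
   of harmonic numbers. *)
have E1 : 2^-1 * (\sum_(0 <= k < n.+1)
      (-1) ^+ k / (p + k%:R) ^+ m.+1 * 'C(n, k)%:R
      * (gharm R 1 n ^+ 2 + gharm R 2 n
         - gharm R 1 (n - k) ^+ 2 - gharm R 2 (n - k))) = - \sum_(k < n.+1) t k.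
  rewrite big_mkord mulr_sumr -sumrN; apply: eq_bigr => k _.
  have [_ h1 h2] := newton_coef_le R (ltn_ord k : (k <= n)%N).
  by rewrite /t /c h1 h2; ring.
rewrite E1.
suff : ccvg (fun N => \sum_(1 <= k < N) ((-1) ^+ n * gharm R 1 k.-1
       / (k%:R * (p + n%:R + k%:R) ^+ m.+1 * 'C(n + k, k)%:R)))
    (- (\sum_(k < n.+1) t k) + (-1) ^+ m / (2 * m`!%:R) * derive1n m F p) by [].
apply: (ccvg_shift 1 _ _).1.
(* The finite sum cancels the first [n.+1] terms of the series, so that its tail, reindexed by
   [k = n + j.+1], is compared with the left-hand side, whose index is [j.+1]. *)
have L := ccvgD (ccvg_cst (- (\sum_(k < n.+1) t k))) ((ccvg_shift n.+1 _ _).2 S).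
apply: (ccvg_eq 0%N _ L) => N _.
rewrite addnC big_split_ord /= addrA addNr add0r.
rewrite addn1 big_add1 /= big_mkord; apply: eq_bigr => j _.
(* Here the [H_n] contributions cancel: [c k] is [- 2 H_j] times the linear coefficient, whose sign
   [(-1) ^+ j] combines with [(-1) ^+ (n + j.+1)] and this minus to [(-1) ^+ n]. *)
have [_ h1 h2] := newton_coef_gt R n j.
rewrite /t /c addSnnS h1 h2 natrD addrA.
have j0 : (j.+1%:R : R[i]) != 0 by rewrite pnatr_eq0.
have b0 : ('C(n + j.+1, j.+1)%:R : R[i]) != 0.
  by rewrite pnatr_eq0 -lt0n bin_gt0 leq_addl.
have q0 : p + n%:R + j.+1%:R != 0 by rewrite -addrA -natrD nonpole_neq0.
rewrite exprD exprS.
transitivity ((-1) ^+ j * (-1) ^+ j * ((-1) ^+ n * gharm R 1 j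
    / (j.+1%:R * (p + n%:R + j.+1%:R) ^+ m.+1 * 'C(n + j.+1, j.+1)%:R))); last first.
  by rewrite sg mul1r.
have q1 : (p + n%:R + j.+1%:R) ^+ m.+1 != 0 by rewrite expf_neq0.
move: ((p + n%:R + j.+1%:R) ^+ m.+1) ('C(n + j.+1, j.+1)%:R : R[i]) (j.+1%:R : R[i]) j0 b0 q1.
move=> a b d d0 b0 a0.
by field; rewrite a0 b0 d0.
Qed.
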